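(* Let $Y=m(X)+\epsilon$, where $X$ is uniformly distributed on $[0,1]^d$, $m:[0,1]^d\to\mathbb{R}$ is a Lipschitz function, and $\epsilon\sim\mathcal{N}(0,\sigma^2)$, $\sigma<\infty$, is independent of $X$. Let $(X_1,Y_1),\dots,(X_n,Y_n)$ be i.i.d. copies of $(X,Y)$, and let $\tilde m^{cc}_{n,\infty}$ be the infinite centered KeRF estimator of depth $k$ built on this sample, in the mean interpolation regime with $2^k=n$. Then there exist constants $c_1,C_3$ depending on $d$, $\sigma$ and $\|m\|_\infty=\sup_{x\in[0,1]^d}|m(x)|$ such that, for every $x\in[0,1]^d$ and every such $n$ with $k=\log_2 n\ge 2$, $$\mathbb{E}\big(\tilde m^{cc}_{n,\infty}(x)-m(x)\big)^2\le c_1\Big(1-\frac1{2d}\Big)^{2\log_2 n}+C_3\,\frac{(\log_2(\log_2 n))^d}{(\log_2 n)^{\frac{d-1}{2}}}\,\log\!\left(\frac{(\log n)\,(\log_2 n)^{\frac{d-1}{2}}}{(\log_2(\log_2 n))^d}\right).$$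
   Context: For $k\in\mathbb{N}$ and $x,z\in[0,1]^d$ the centered random forest kernel is $$K_k(x,z)=\sum_{\substack{k_1,\dots,k_d\ge 0\\ k_1+\cdots+k_d=k}}\frac{k!}{k_1!\cdots k_d!}\Big(\frac1d\Big)^k\prod_{j=1}^d \mathbf{1}_{\lceil 2^{k_j}x_j\rceil=\lceil 2^{k_j}z_j\rceil}.$$ The infinite centered KeRF (kernel random forest) estimator of depth $k$ built on the sample $(X_1,Y_1),\dots,(X_n,Y_n)$ is $$\tilde m^{cc}_{n,\infty}(x)=\frac{\sum_{i=1}^n Y_iK_k(x,X_i)}{\sum_{i=1}^n K_k(x,X_i)},\qquad x\in[0,1]^d,$$ with the convention $0/0=0$. The mean interpolation regime means that each tree has at least $n$ cells, i.e. $2^k\ge n$. The expectation is over the training sample; $\log$ is the natural logarithm. The constants do not depend on $n$ or $x$.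
   Formalization: The constant c_1 may also depend on the Lipschitz constant of m (uniformity over all Lipschitz m of given sup norm fails for d≥2), and points with x_j=0 are put in the leftmost dyadic cell, since the bare ceiling makes the estimator a.s. 0 there and the bound false. *)

(* Defs.v *)
(* MathComp / MathComp-Analysis. *)
From HB Require Import structures.
From mathcomp Require Import all_boot all_order all_algebra.
From mathcomp Require Import all_classical all_reals all_analysis.
Set Implicit Arguments.
Unset Strict Implicit.
Unset Printing Implicit Defensive.
Import Order.TTheory GRing.Theory Num.Theory.
Local Open Scope classical_set_scope.
Local Open Scope ring_scope.

(* Points of R^d are d-tuples, since [d.-tuple R] carries the product
   sigma-algebra.  A function on [0,1]^d is a function on [d.-tuple R] whose
   values outside [unit_cube] are never used. *)
Definition unit_cube (R : realType) (d : nat) : set (d.-tuple R) :=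
  [set x | forall j, 0 <= tnth x j <= 1].

Definition euclidean_dist (R : realType) (d : nat) (x z : d.-tuple R) : R :=
  Num.sqrt (\sum_(j < d) (tnth x j - tnth z j) ^+ 2).

Definition lipschitz_on_cube (R : realType) (d : nat) (L : R)
    (m : d.-tuple R -> R) : Prop :=
  forall x z, unit_cube x -> unit_cube z ->
    `|m x - m z| <= L * euclidean_dist x z.

Definition sup_norm (R : realType) (d : nat) (m : d.-tuple R -> R) : R :=
  sup [set `|m x| | x in @unit_cube R d].

(* Index of the cell containing t in the partition of [0,1] into 2^q dyadic
   cells [0, 2^-q], ]2^-q, 2 * 2^-q], ..., ]1 - 2^-q, 1].  The bare formula
   ceil (2^q t) would put t = 0 in a cell {0} of its own, of measure zero; here
   0 belongs to the leftmost cell. *)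
Definition cell_index (R : realType) (q : nat) (t : R) : int :=
  Num.max 1 (Num.ceil (2 ^+ q * t)).

Lemma cell_index_gt0 (R : realType) (q : nat) (t : R) :
  0 < t -> cell_index q t = Num.ceil (2 ^+ q * t).
Proof.
move=> t0; rewrite /cell_index; apply/max_idPr.
by rewrite -gtz0_ge1 ceil_gt0 mulr_gt0// exprn_gt0.
Qed.

Definition centered_kernel (R : realType) (d k : nat) (x z : d.-tuple R) : R :=
  \sum_(kk : {ffun 'I_d -> 'I_k.+1} | (\sum_(j < d) kk j)%N == k)
    (k`!%:R / \prod_(j < d) (kk j)`!%:R) * (1 / d%:R) ^+ k *
    \prod_(j < d)
      (cell_index (kk j) (tnth x j) == cell_index (kk j) (tnth z j))%:R.

(* The convention 0 / 0 = 0 is that of MathComp division. *)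
Definition centered_kerf (R : realType) (d k n : nat) (T : Type)
    (X : 'I_n -> T -> d.-tuple R) (Y : 'I_n -> T -> R)
    (x : d.-tuple R) (w : T) : R :=
  (\sum_(i < n) Y i w * centered_kernel k x (X i w)) /
  (\sum_(i < n) centered_kernel k x (X i w)).

(* The uniform law on [0,1]^d is the product of d copies of the uniform law on
   [0,1]; it is characterized by its values on measurable rectangles. *)
Definition uniform_on_cube (R : realType) (disp : measure_display)
    (T : measurableType disp) (P : probability T R) (d : nat)
    (X : T -> d.-tuple R) : Prop :=
  (forall w, unit_cube (X w)) /\
  forall A : 'I_d -> set R, (forall j, measurable (A j)) ->
    P (X @^-1` [set x | forall j, A j (tnth x j)]) =
    (\prod_(j < d) uniform_prob (@ltr01 R) (A j))%E.

(* [normal_prob 0 s] is the normal law with standard deviation s only when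
   s != 0; N(0, 0) is the Dirac mass at 0. *)
Definition centered_normal (R : realType) (s : R) (A : set R) : \bar R :=
  if s == 0 then \d_(0 : R) A else normal_prob 0 s A.

Definition independent2 (R : realType) (disp d1 d2 : measure_display)
    (T : measurableType disp) (P : probability T R)
    (T1 : measurableType d1) (T2 : measurableType d2)
    (U : T -> T1) (V : T -> T2) : Prop :=
  forall (A : set T1) (B : set T2), measurable A -> measurable B ->
    P (U @^-1` A `&` V @^-1` B) = (P (U @^-1` A) * P (V @^-1` B))%E.

Definition mutually_independent (R : realType) (disp d1 : measure_display)
    (T : measurableType disp) (P : probability T R)
    (T1 : measurableType d1) (n : nat) (Z : 'I_n -> T -> T1) : Prop :=
  forall (J : {set 'I_n}) (A : 'I_n -> set T1),
    (forall i, measurable (A i)) ->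
    P (\bigcap_(i in [set i | i \in J]) (Z i @^-1` A i)) =
    (\prod_(i in J) P (Z i @^-1` A i))%E.

(* These clauses determine the joint law of (X, Y). *)
Definition regression_pair (R : realType) (disp : measure_display)
    (T : measurableType disp) (P : probability T R) (d : nat)
    (m : d.-tuple R -> R) (sigma : R)
    (X : {RV P >-> d.-tuple R}) (Y : {RV P >-> R}) : Prop :=
  uniform_on_cube P X /\
  exists eps : {RV P >-> R},
    [/\ forall w, Y w = m (X w) + eps w,
        forall A, measurable A -> distribution P eps A = centered_normal sigma A
      & independent2 P X eps].

(* The pairs are i.i.d.: by [regression_pair] they all have the same law. *)
Definition regression_sample (R : realType) (disp : measure_display)
    (T : measurableType disp) (P : probability T R) (d n : nat)
    (m : d.-tuple R -> R) (sigma : R)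
    (X : 'I_n -> {RV P >-> d.-tuple R}) (Y : 'I_n -> {RV P >-> R}) : Prop :=
  (forall i, regression_pair m sigma (X i) (Y i)) /\
  mutually_independent P (fun i w => (X i w, Y i w)).

Definition log2 (R : realType) (y : R) : R := ln y / ln 2.

(* Main.v *)
(* Write U_i = Y_i - m(x), K_i = K_k(x, X_i), S = sum_i K_i and n = 2^k, so that
   E S = 1.  Pointwise, the squared error is at most
     4 (sum_i K_i U_i)^2 + 1_{S < 1/2} (M^2 + sum_i (K_i / S) U_i^2),
   and 1_{S < 1/2} <= 4 (S - 1)^2.  Both (sum_i K_i U_i)^2 and (S - 1)^2 are
   squares of sums of independent variables.  Their variances are O(n E K^2); the
   squared mean of the former is at most (|L| d)^2 (1 - 1/(2d))^(2k), because two
   points sharing a cell of depth k_j differ by at most 2^-k_j in coordinate j.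
   On {S < 1/2}, U_i^2 has bounded conditional expectation given all the cells.
   Finally n E K^2 = E 2^(- |kappa - kappa'|_1 / 2) for independent multinomial
   kappa, kappa', which is at most a constant times the largest multinomial
   probability, hence O(k^(-(d-1)/2)).  For large k the logarithm in the bound is
   at least 1, so this is below the second term; the finitely many other k are
   absorbed in c1. *)
Require Import Defs.
From HB Require Import structures.
From mathcomp Require Import all_boot all_order all_algebra.
From mathcomp Require Import all_classical all_reals all_analysis.
From mathcomp Require Import measurable_realfun ring lra zify.
Set Implicit Arguments.
Unset Strict Implicit.
Unset Printing Implicit Defensive.
Import Order.TTheory GRing.Theory Num.Theory.
Local Open Scope classical_set_scope.
Local Open Scope ring_scope.

(** * Multinomial probabilities *)

(** The denominator S has no positive lower bound, so its inverse cannot be controlled in mean.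
    Where 0 < S < 1/2 the estimator is however a convex average of the Y_i, and Jensen's inequality
    removes the denominator, at the price of weights that depend on all the X_i at once. These
    weights see the sample only through finitely many cell memberships, so conditioning on the cells
    is a finite sum over codes and no conditional expectation has to be constructed. The largest
    multinomial probability is bounded by integer inequalities and an induction on equal splits, in
    place of Stirling's formula. The constant [L] enters the bound through the squared bias alone,
    which is why [C3] can be chosen before [L] and only [c1] after it. *)

Lemma coef_prod_exp_trunc (R : numFieldType) (I : Type) (s : seq I) (a : I -> R)
    (k l : nat) : (l <= k)%N ->
  (\prod_(j <- s) \poly_(i < k.+1) (a j ^+ i / i`!%:R))`_l =
  (\sum_(j <- s) a j) ^+ l / l`!%:R.
Proof.
elim: s l => [|j s IH] l lk.
  by rewrite !big_nil coef1; case: l lk => [|l] _; rewrite ?expr0 ?fact0 ?divr1// expr0n mul0r.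
rewrite !big_cons coefM addrC exprDn mulr_suml; apply: eq_bigr => i _.
have il : (i <= l)%N by rewrite -ltnS.
rewrite coef_poly ltnS (leq_trans il lk) IH; last by rewrite (leq_trans _ lk)// leq_subr.
rewrite -mulr_natr -(bin_fact il) !natrM.
have f0 m : m`!%:R != 0 :> R by rewrite pnatr_eq0 -lt0n fact_gt0.
have b0 : 'C(l, i)%:R != 0 :> R by rewrite pnatr_eq0 -lt0n bin_gt0.
by field; rewrite !f0 b0.
Qed.

(** Both sides are the coefficient of degree [k] in a product of exponential series. Truncating each
    series at degree [k] leaves that coefficient unchanged and makes the expansion run over
    [{ffun 'I_d -> 'I_k.+1}], the index set of the kernel. *)
Lemma multinomial_sum (R : numFieldType) (d k : nat) (a : 'I_d -> R) :
  \sum_(f : {ffun 'I_d -> 'I_k.+1} | (\sum_j f j)%N == k)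
    \prod_j (a j ^+ f j / (f j)`!%:R) = (\sum_j a j) ^+ k / k`!%:R.
Proof.
rewrite -(@coef_prod_exp_trunc _ _ _ a k)//.
under [X in _ = nth _ (polyseq X) _]eq_bigr do rewrite poly_def.
rewrite bigA_distr_bigA/= coef_sum big_mkcond; apply: eq_bigr => f _.
rewrite scaler_prod prodrXr.
by rewrite coefZ coefXn eq_sym; case: eqP => _; rewrite ?mulr1 ?mulr0.
Qed.

Definition multinomial_weight (R : realFieldType) (d k : nat)
    (kk : {ffun 'I_d -> 'I_k.+1}) : R :=
  (k`!%:R / \prod_(j < d) (kk j)`!%:R) * (1 / d%:R) ^+ k.

Lemma multinomial_weight_ge0 (R : realFieldType) (d k : nat)
    (kk : {ffun 'I_d -> 'I_k.+1}) : 0 <= multinomial_weight R kk.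
Proof.
by rewrite mulr_ge0 ?exprn_ge0 ?divr_ge0// prodr_ge0.
Qed.

(** The generating function of the multinomial law. Taking [b] equal to 1 gives total mass 1, equal
    to 1/2 the mean of the kernel, and 1/2 in a single coordinate the bias factor. *)
Lemma multinomial_weight_sum (R : realFieldType) (d k : nat) (b : 'I_d -> R) :
  \sum_(kk : {ffun 'I_d -> 'I_k.+1} | (\sum_j kk j)%N == k)
     multinomial_weight R kk * \prod_j b j ^+ kk j =
  ((\sum_j b j) / d%:R) ^+ k.
Proof.
have f0 m : m`!%:R != 0 :> R by rewrite pnatr_eq0 -lt0n fact_gt0.
have := multinomial_sum k (fun j => b j / d%:R).
rewrite -mulr_suml => /(congr1 ( *%R^~ k`!%:R)); rewrite divfK// => <-.
rewrite mulr_suml; apply: eq_bigr => kk /eqP kkk.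
rewrite prodf_div.
under [X in _ = X / _ * _]eq_bigr do rewrite exprMn.
rewrite big_split/= prodrXr kkk/= /multinomial_weight div1r.
have p0 : \prod_j (kk j)`!%:R != 0 :> R by apply/prodf_neq0.
by field; rewrite p0.
Qed.

(** * Upper bound for the largest multinomial probability *)

(** The quantity (q+1)^a / a! is largest at a = q: passing from a to a + 1 multiplies it by
    (q+1)/(a+1), which is at least 1 exactly when a <= q. *)
Lemma fact_shift_le (q a : nat) : (q`! * q.+1 ^ a <= a`! * q.+1 ^ q)%N.
Proof.
have [/subnK <-|/ltnW] := leqP q a.
  elim: (a - q)%N => [|m IH]; first by rewrite add0n.
  rewrite addSn factS expnS; nia.
suff H r : (r <= q.+1 -> a <= r -> r`! * q.+1 ^ a <= a`! * q.+1 ^ r)%N by exact: H.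
elim: r => [|r IH] rq; first by rewrite leqn0 => /eqP ->.
rewrite leq_eqVlt => /orP[/eqP ->//|]; rewrite ltnS => ar.
have := IH (ltnW rq) ar; rewrite factS [(_ ^ r.+1)%N]expnS; nia.
Qed.

(** The multinomial probability of the equal split (q, ..., q) at depth d q. *)
Definition balanced_prob (R : realFieldType) (d q : nat) : R :=
  (d * q)`!%:R / (q`!%:R ^+ d * d%:R ^+ (d * q)).

Lemma fact_addn_le (m r : nat) : ((m + r)`! <= m`! * (m + r) ^ r)%N.
Proof.
elim: r => [|r IH]; first by rewrite addn0 muln1.
rewrite addnS factS expnS mulnCA leq_mul2l/=; apply: (leq_trans IH).
by rewrite leq_mul2l; case: r {IH} => [|r]; rewrite ?orbT// leq_exp2r// leqnSn orbT.
Qed.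

(** Rounding the depth k = d q + r down to d q costs nothing: by [fact_shift_le] in each coordinate
    the product of the factorials is at least q!^d (q+1)^r, while k! is at most (d q)! (d (q+1))^r;
    the powers of q + 1 cancel and d^r goes into d^k. *)
Lemma multinomial_weight_le_balanced (R : realFieldType) (d k : nat)
    (kk : {ffun 'I_d -> 'I_k.+1}) : (0 < d)%N -> (\sum_j kk j)%N = k ->
  multinomial_weight R kk <= balanced_prob R d (k %/ d).
Proof.
move=> d0 kkk; set q := (k %/ d)%N; set r := (k %% d)%N.
have kE : (k = d * q + r)%N by rewrite mulnC -divn_eq.
have rd : (r < d)%N by rewrite ltn_mod.
have F : (q`! ^ d * q.+1 ^ r <= \prod_j (kk j)`!)%N.
  have : (\prod_(j < d) (q`! * q.+1 ^ kk j) <= \prod_(j < d) ((kk j)`! * q.+1 ^ q))%N.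
    by apply: leq_prod => j _; exact: fact_shift_le.
  rewrite !big_split/= prod_nat_const card_ord -expn_sum kkk prod_nat_const card_ord.
  rewrite {1}kE expnD -expnM (mulnC q) mulnCA mulnC [X in (X <= _)%N]mulnC.
  rewrite [X in (X <= _)%N]mulnA [(q`! ^ d * _)%N]mulnC -mulnA mulnC.
  by rewrite leq_pmul2r ?expn_gt0// mulnC.
have G : (k`! <= (d * q)`! * (d * q.+1) ^ r)%N.
  rewrite {1}kE (leq_trans (fact_addn_le _ _))// leq_mul2l.
  have [->//|r0] := posnP r; first by rewrite !expn0 orbT.
  by rewrite leq_exp2r// mulnS addnC leq_add2r (ltnW rd) orbT.
have H : (k`! * (q`! ^ d * d ^ (d * q)) <= (d * q)`! * (\prod_j (kk j)`! * d ^ k))%N.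
  apply: (@leq_trans ((d * q)`! * (d * q.+1) ^ r * (q`! ^ d * d ^ (d * q)))).
    by rewrite leq_mul2r G orbT.
  have -> : (d ^ k = d ^ (d * q) * d ^ r)%N by rewrite -expnD -kE.
  rewrite -mulnA leq_mul2l expnMn; apply/orP; right.
  have E (x y z w : nat) : (x * y * (z * w) = z * y * (w * x))%N by ring.
  by rewrite E leq_mul.
rewrite /multinomial_weight /balanced_prob -natr_prod div1r exprVn -mulrA -invfM.
have P0 : (0 < \prod_j (kk j)`!)%N by apply: prodn_gt0 => j; exact: fact_gt0.
rewrite ler_pdivrMr ?mulr_gt0 ?exprn_gt0 ?ltr0n//.
rewrite mulrAC ler_pdivlMr ?mulr_gt0 ?exprn_gt0 ?ltr0n ?fact_gt0//.
by rewrite -!natrX -!natrM ler_nat.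
Qed.

Lemma fact_prod_addn (m r : nat) : ((m + r)`! = m`! * \prod_(i < r) (m + i.+1))%N.
Proof.
elim: r => [|r IH]; first by rewrite addn0 big_ord0 muln1.
by rewrite addnS factS IH big_ord_recr/= addnS mulnC mulnA.
Qed.

(* AM-GM on the pairs i, d - 1 - i bounds the ratio of consecutive balanced probabilities. *)
Lemma balanced_step (d q : nat) :
  ((\prod_(i < d) (d.+1 * q + i.+1)) ^ 2 * (q.+1.*2.+1) ^ d <=
   ((d.+1 * q.+1) ^ d) ^ 2 * (q.*2.+1) ^ d)%N.
Proof.
rewrite [in leqRHS]expnAC.
have -> : ((\prod_(i < d) (d.+1 * q + i.+1)) ^ 2 * (q.+1.*2.+1) ^ d =
   \prod_(i < d) ((d.+1 * q + i.+1) * (d.+1 * q + (rev_ord i).+1) * q.+1.*2.+1))%N.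
  rewrite !big_split/= prod_nat_const card_ord -mulnn; congr (_ * _ * _)%N.
  by rewrite [LHS](reindex_inj rev_ord_inj).
have c x : (x ^ d = \prod_(i < d) x)%N by rewrite prod_nat_const card_ord.
rewrite -expnMn [leqRHS]c.
apply: leq_prod => i _ /=.
set A := (_ + i.+1)%N; set B := (_ + (d - i.+1).+1)%N.
have AB : (A + B = d.+1 * q.*2.+1)%N by have := ltn_ord i; rewrite /A /B; nia.
have AG := (nat_AGM2 A B).1.
have Q : (q.*2.+1 * q.+1.*2.+1 <= 4 * q.+1 ^ 2)%N by rewrite -mulnn; nia.
rewrite -(@leq_pmul2l 4)// mulnA (leq_trans (leq_mul AG (leqnn _)))// AB.
move: (leq_mul (leqnn (d.+1 * d.+1 * q.*2.+1)) Q); rewrite -!mulnn.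
by move: d.+1 q.*2.+1 q.+1.*2.+1 q.+1 => D u v t; lia.
Qed.

(** The sharp order q^(-d/2) for [d.+1] coordinates. The odd number 2q + 1 makes the bound an
    equality at q = 0 and lets each induction step reduce to AM-GM; squaring keeps everything
    rational. *)
Lemma balanced_prob_bound (R : realFieldType) (d q : nat) :
  balanced_prob R d.+1 q ^+ 2 * (q.*2.+1)%:R ^+ d <= 1.
Proof.
elim: q => [|q IH].
  by rewrite /balanced_prob muln0 fact0 expr0 !(expr1n, mulr1, divr1).
set p := (\prod_(i < d) (d.+1 * q + i.+1))%N.
set N := (d.+1 * q.+1)%N.
(* Of the d + 1 new factors of the factorial, the last is (d+1)(q+1) and cancels one power of the
   denominator, so only d factors remain in [p]. *)
have bE : balanced_prob R d.+1 q.+1 = balanced_prob R d.+1 q * (p%:R / N%:R ^+ d).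
  rewrite /balanced_prob [in LHS]mulnS addnC fact_prod_addn big_ord_recr/= -/p.
  have mE : (d.+1 * q + d.+1)%:R = d.+1%:R * q.+1%:R :> R by rewrite -natrM mulnSr.
  rewrite /N factS !natrM mE !exprMn exprD !(exprS _ d).
  have q0 : q`!%:R != 0 :> R by rewrite pnatr_eq0 -lt0n fact_gt0.
  have q1 : q.+1%:R != 0 :> R by rewrite pnatr_eq0.
  have d1 : d.+1%:R != 0 :> R by rewrite pnatr_eq0.
  by field; rewrite !expf_neq0// nat1r d1 nat1r q1 q0.
rewrite bE exprMn -mulrA; apply: le_trans IH.
rewrite ler_wpM2l ?sqr_ge0// exprMn exprVn mulrAC ler_pdivrMr ?exprn_gt0 ?ltr0n ?muln_gt0//.
rewrite [leRHS]mulrC -!natrX -!natrM ler_nat; exact: balanced_step.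
Qed.

Lemma multinomial_weight_le (R : rcfType) (d k : nat)
    (kk : {ffun 'I_d.+1 -> 'I_k.+1}) : (0 < k)%N -> (\sum_j kk j)%N = k ->
  multinomial_weight R kk <= Num.sqrt (d.+1%:R / k%:R) ^+ d.
Proof.
move=> k0 kkk; apply: (le_trans (multinomial_weight_le_balanced R _ kkk)) => //.
rewrite -(@ler_pXn2r _ 2)// ?nnegrE ?exprn_ge0 ?sqrtr_ge0//; last first.
  by rewrite divr_ge0// mulr_ge0// exprn_ge0.
rewrite exprAC sqr_sqrtr ?divr_ge0//.
have := balanced_prob_bound R d (k %/ d.+1); set q := (k %/ d.+1)%N.
rewrite -ler_pdivlMr ?exprn_gt0 ?ltr0n// => /le_trans; apply.
rewrite div1r -exprVn lerXn2r ?nnegrE ?invr_ge0 ?divr_ge0//.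
rewrite -[X in X^-1]divr1 invf_div ler_pdivrMr ?ltr0n// mulrAC ler_pdivlMr ?ltr0n//.
rewrite mul1r -natrM ler_nat.
(* Here k < (d+1)(q+1) <= (d+1)(2q+1), which covers q = 0 as well. *)
have := ltn_ceil k (ltn0Sn d); rewrite -/q; nia.
Qed.

(** * Collisions of two independent multinomial splits *)

Lemma sum_geom_le (R : realFieldType) (n : nat) : \sum_(a < n) (3 / 4 : R) ^+ a <= 4.
Proof.
have p0 : 0 <= (3 / 4 : R) ^+ n by rewrite exprn_ge0// divr_ge0.
have := subrX1 (3 / 4 : R) n; lra.
Qed.

Lemma sum_geom_dist_le (R : realFieldType) (k b : nat) :
  \sum_(a < k) (3 / 4 : R) ^+ ((a - b) + (b - a)) <= 8.
Proof.
have p0 (n : nat) : 0 <= (3 / 4 : R) ^+ n by rewrite exprn_ge0// divr_ge0.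
have kk : (k <= b + k)%N by rewrite leq_addl.
rewrite -(big_mkord xpredT (fun a : nat => (3 / 4 : R) ^+ ((a - b) + (b - a)))).
have -> : (8 : R) = 4 + 4 by ring.
(* Extending the range to [b + k] allows a split at [b] even when [k <= b]; each half is a geometric
   sum of at most 4. *)
apply: (@le_trans _ _ (\sum_(0 <= a < b + k) (3 / 4 : R) ^+ ((a - b) + (b - a)))).
  by rewrite [leRHS](big_cat_nat (n := k))//= lerDl sumr_ge0.
rewrite (big_cat_nat (n := b)) ?leq_addr//=; apply: lerD.
  rewrite big_nat_rev/= add0n.
  apply: le_trans (sum_geom_le R b.+1).
  rewrite -(big_mkord xpredT (fun a : nat => (3 / 4 : R) ^+ a)) big_nat_recl//.
  rewrite -[leLHS]add0r lerD//; apply: ler_sum_nat => a /andP[_ ab].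
  by rewrite le_eqVlt; apply/orP; left; apply/eqP; congr (_ ^+ _); lia.
rewrite -{1}[b]add0n big_addn/= addKn big_mkord; apply: le_trans (sum_geom_le R k).
by apply: ler_sum => /= a _; have -> : ((a + b - b) + (b - (a + b)) = a)%N by lia.
Qed.

(* [3 / 4] is a rational upper bound of [2^(-1/2)]. *)
Lemma prod_max_le (R : realFieldType) (d k : nat) (f g : {ffun 'I_d -> 'I_k.+1}) :
  (\sum_j f j)%N = k -> (\sum_j g j)%N = k ->
  \prod_j (1 / 2 : R) ^+ maxn (f j) (g j) <=
  (1 / 2) ^+ k * \prod_j (3 / 4) ^+ ((f j - g j) + (g j - f j)).
Proof.
move=> fk gk; rewrite !prodrXr big_split/=.
have E1 : (\sum_j maxn (f j) (g j) = k + \sum_j (f j - g j))%N.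
  transitivity (\sum_j g j + \sum_j (f j - g j))%N; last by rewrite gk.
  by rewrite -big_split/=; apply: eq_bigr => j _; rewrite maxnC maxnE.
have E2 : (\sum_j maxn (f j) (g j) = k + \sum_j (g j - f j))%N.
  transitivity (\sum_j f j + \sum_j (g j - f j))%N; last by rewrite fk.
  by rewrite -big_split/=; apply: eq_bigr => j _; rewrite maxnE.
(* Equal totals force the positive and negative parts of f - g to have the same sum, so the maxima
   add up to k plus half the l1 distance. *)
have -> : (\sum_j (g j - f j) = \sum_j (f j - g j))%N.
  by apply/eqP; rewrite -(eqn_add2l k) -E1 -E2.
rewrite E1 exprD ler_wpM2l ?exprn_ge0 ?divr_ge0// addnn -mul2n exprM.
by rewrite lerXn2r ?nnegrE ?sqr_ge0 ?divr_ge0//; lra.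
Qed.

(** The weight of [g] is replaced by its maximum while [f] keeps its probability law. Once the
    constraint on the total of [g] is dropped, the sum over [g] factorizes into one two-sided
    geometric sum per coordinate, whence 8^d. *)
Lemma collision_weight_le (R : rcfType) (d k : nat) : (0 < d)%N -> (0 < k)%N ->
  \sum_(f : {ffun 'I_d -> 'I_k.+1} | (\sum_j f j)%N == k)
  \sum_(g : {ffun 'I_d -> 'I_k.+1} | (\sum_j g j)%N == k)
    multinomial_weight R f * multinomial_weight R g *
      \prod_j (1 / 2) ^+ maxn (f j) (g j) <=
  (1 / 2) ^+ k * (8 ^+ d * Num.sqrt (d%:R / k%:R) ^+ d.-1).
Proof.
case: d => // d _ k0 /=; set s := Num.sqrt _ ^+ d.
have s0 : 0 <= s by rewrite exprn_ge0// sqrtr_ge0.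
have p0 (n : nat) : 0 <= (3 / 4 : R) ^+ n by rewrite exprn_ge0// divr_ge0.
have w1 : \sum_(f : {ffun 'I_d.+1 -> 'I_k.+1} | (\sum_j f j)%N == k)
    multinomial_weight R f = 1.
  have := multinomial_weight_sum k (fun _ : 'I_d.+1 => 1 : R).
  rewrite sumr_const card_ord divff ?pnatr_eq0 ?expr1n => // <-.
  by apply: eq_bigr => f _; rewrite big1 ?mulr1// => j _; rewrite expr1n.
apply: (@le_trans _ _ (\sum_(f : {ffun 'I_d.+1 -> 'I_k.+1} | (\sum_j f j)%N == k)
    multinomial_weight R f * ((1 / 2) ^+ k * (8 ^+ d.+1 * s)))); last first.
  by rewrite -mulr_suml w1 mul1r.
apply: ler_sum => f /eqP fk.
under eq_bigr do rewrite -mulrA.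
rewrite -mulr_sumr ler_wpM2l ?multinomial_weight_ge0//.
apply: (@le_trans _ _ (\sum_(g : {ffun 'I_d.+1 -> 'I_k.+1} | (\sum_j g j)%N == k)
    (1 / 2) ^+ k * s * \prod_j (3 / 4) ^+ ((f j - g j) + (g j - f j)))).
  apply: ler_sum => g /eqP gk; rewrite [in leRHS](mulrC _ s) -[leRHS]mulrA.
  apply: ler_pM.
  - exact: multinomial_weight_ge0.
  - by apply: prodr_ge0 => j _; rewrite exprn_ge0// divr_ge0.
  - exact: multinomial_weight_le.
  - exact: prod_max_le.
rewrite -mulr_sumr mulrA [leRHS]mulrAC ler_wpM2l ?mulr_ge0 ?exprn_ge0 ?divr_ge0 ?sqrtr_ge0//.
apply: (@le_trans _ _ (\sum_(g : {ffun 'I_d.+1 -> 'I_k.+1})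
    \prod_j (3 / 4) ^+ ((f j - g j) + (g j - f j)))).
  rewrite [leLHS]big_mkcond; apply: ler_sum => g _; case: ifP => // _.
  exact: prodr_ge0.
rewrite -(bigA_distr_bigA (fun j (a : 'I_k.+1) => (3 / 4 : R) ^+ ((f j - a) + (a - f j)))).
have -> : (8 ^+ d.+1 : R) = \prod_(j < d.+1) 8 by rewrite prodr_const card_ord.
apply: ler_prod => j _; rewrite sumr_ge0//=.
by under eq_bigr do rewrite addnC; exact: sum_geom_dist_le.
Qed.

(** * Expectation and independence *)

Local Notation integrableR P f := (P.-integrable setT (EFin \o f)).

Section real_integrals.
Context (R : realType) (disp : measure_display) (T : measurableType disp)
  (P : probability T R).
Implicit Types f g : T -> R.

Lemma integrable_measurable f : integrableR P f -> measurable_fun setT f.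
Proof. by move=> /measurable_int/measurable_EFinP. Qed.

Lemma integrable_le f g : measurable_fun setT f -> integrableR P g ->
  (forall w, `|f w| <= g w) -> integrableR P f.
Proof.
move=> mf ig fg; apply: (le_integrable measurableT _ _ ig).
  exact/measurable_EFinP.
by move=> w _; rewrite /= lee_fin (le_trans (fg w))// ler_norm.
Qed.

Lemma integrable_cst (c : R) : integrableR P (fun=> c).
Proof. exact: finite_measure_integrable_cst. Qed.

Lemma integrable_bounded (c : R) f : measurable_fun setT f ->
  (forall w, `|f w| <= c) -> integrableR P f.
Proof. by move=> mf fc; exact: (integrable_le mf (integrable_cst c)). Qed.

Lemma integrable_add f g : integrableR P f -> integrableR P g -> integrableR P (fun w => f w + g w).
Proof. by move=> fi gi; exact: (integrableD measurableT fi gi). Qed.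

Lemma integrable_scale (c : R) f : integrableR P f -> integrableR P (fun w => c * f w).
Proof. by move=> fi; exact: (integrableZl measurableT c fi). Qed.

Lemma integrable_bigsum (I : Type) (s : seq I) (f : I -> T -> R) :
  (forall i, integrableR P (f i)) -> integrableR P (fun w => \sum_(i <- s) f i w).
Proof.
move=> fi.
have := @integrable_sum _ _ _ P _ measurableT _ s xpredT _ (fun i _ => fi i).
by under eq_fun do rewrite /= sumEFin.
Qed.

Lemma Rintegral_bigsum (I : Type) (s : seq I) (f : I -> T -> R) :
  (forall i, integrableR P (f i)) ->
  \int[P]_w (\sum_(i <- s) f i w) = \sum_(i <- s) \int[P]_w f i w.
Proof.
move=> fi; elim: s => [|i s IH].
  by under eq_Rintegral do rewrite big_nil; rewrite Rintegral_cst// mul0r big_nil.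
under eq_Rintegral do rewrite big_cons.
by rewrite RintegralD ?big_cons ?IH//; exact: integrable_bigsum.
Qed.

Lemma Rintegral_const (c : R) : \int[P]_w c = c.
Proof. by rewrite Rintegral_cst//= probability_setT mulr1. Qed.

Lemma EFin_Rintegral f : integrableR P f -> (\int[P]_w f w)%:E = (\int[P]_w (f w)%:E)%E.
Proof. by move=> fi; rewrite fineK//; exact: integrable_fin_num. Qed.

Lemma integrable_of_sqr f : measurable_fun setT f ->
  integrableR P (fun w => f w ^+ 2) -> integrableR P f.
Proof.
move=> mf f2; apply: (integrable_le mf (integrable_add (integrable_cst 1) f2)) => w.
have := sqr_ge0 (`|f w| - 1); rewrite -(real_normK (num_real (f w))); nra.
Qed.

(* The joint law of independent U and V is the product of their laws, so Fubini applies. *)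
Lemma independent_expectation f g : independent2 P f g -> integrableR P f -> integrableR P g ->
  integrableR P (fun w => f w * g w) /\
  \int[P]_w (f w * g w) = (\int[P]_w f w) * (\int[P]_w g w).
Proof.
move=> fg fi gi.
have mf := integrable_measurable fi; have mg := integrable_measurable gi.
pose U : {mfun T >-> R} := HB.pack f (isMeasurableFun.Build _ _ _ _ f mf).
pose V : {mfun T >-> R} := HB.pack g (isMeasurableFun.Build _ _ _ _ g mg).
have mW : measurable_fun setT (fun w => (f w, g w)) by exact: measurable_fun_pair.
pose W : {mfun T >-> (R * R)%type} :=
  HB.pack (fun w => (f w, g w)) (isMeasurableFun.Build _ _ _ _ _ mW).
pose m1 : probability R R := distribution P U.
pose m2 : probability R R := distribution P V.
have mE A : measurable A -> (m1 \x m2)%E A = distribution P W A.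
  by move=> mA; exact: (@product_measure_unique _ _ _ _ _ m1 m2 (distribution P W)).
have mxy : measurable_fun setT (fun z : R * R => (z.1 * z.2)%:E).
  by apply/measurable_EFinP; apply: measurable_funM.
have iU : m1.-integrable setT (EFin : R -> \bar R) by exact: integrable_pushforward.
have iV : m2.-integrable setT (EFin : R -> \bar R) by exact: integrable_pushforward.
have [c1 c2] : ((\int[m1]_x `|x%:E| < +oo) /\ (\int[m2]_y `|y%:E| < +oo))%E.
  by split; [case/integrableP: iU|case/integrableP: iV].
have ixy : (m1 \x m2)%E.-integrable setT (fun z : R * R => (z.1 * z.2)%:E).
  apply/integrable12ltyP => //=.
  under eq_integral => x _.
    under eq_integral do rewrite normrM EFinM.
    rewrite ge0_integralZl//; last by apply/measurable_EFinP; exact: normr_measurable.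
    over.
  rewrite ge0_integralZr//; first (apply: lte_mul_pinfty => //).
    - exact: integral_ge0.
    - by rewrite ge0_fin_numE//; exact: integral_ge0.
    by apply/measurable_EFinP; exact: normr_measurable.
  by apply: integral_ge0.
have iW : (distribution P W).-integrable setT (fun z : R * R => (z.1 * z.2)%:E).
  apply/integrableP; split=> //; case/integrableP: ixy => _; apply: le_lt_trans.
  by rewrite le_eqVlt; apply/orP; left; apply/eqP/eq_measure_integral => A mA _; exact/esym/mE.
have iP : integrableR P (fun w => f w * g w).
  apply/integrableP; split; first by apply/measurable_EFinP; exact: measurable_funM.
  case/integrableP: iW => _; rewrite ge0_integral_distribution//.
  exact: measurableT_comp.
split=> //; apply: EFin_inj; rewrite EFinM EFin_Rintegral//.
have <- : (\int[distribution P W]_z (z.1 * z.2)%:E = \int[P]_w (f w * g w)%:E)%E.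
  by rewrite integral_distribution.
rewrite -(@eq_measure_integral _ _ _ _ (distribution P W) (m1 \x m2)%E); last first.
  by move=> A mA _; exact: mE.
rewrite -integral12_prod_meas1//.
have h1 : (\int[m1]_x x%:E = (\int[P]_w f w)%:E)%E.
  by rewrite integral_distribution// EFin_Rintegral.
have h2 : (\int[m2]_x x%:E = (\int[P]_w g w)%:E)%E.
  by rewrite integral_distribution// EFin_Rintegral.
rewrite /fubini_F/=.
under eq_integral => x _.
  under eq_integral do rewrite EFinM.
  rewrite integralZl// h2; over.
by rewrite integralZr// h1.
Qed.

End real_integrals.

Section second_moment.
Context (R : realType) (disp : measure_display) (T : measurableType disp)
  (P : probability T R).

Lemma second_moment_sum (n : nat) (V : 'I_n -> T -> R) (v b : R) :
  (forall i, measurable_fun setT (V i)) ->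
  (forall i, integrableR P (fun w => V i w ^+ 2)) ->
  (forall i j, i != j -> independent2 P (V i) (V j)) ->
  (forall i, \int[P]_w (V i w ^+ 2) <= v) ->
  (forall i, `|\int[P]_w V i w| <= b) ->
  integrableR P (fun w => (\sum_i V i w) ^+ 2) /\
  \int[P]_w ((\sum_i V i w) ^+ 2) <= n%:R * v + (n%:R * b) ^+ 2.
Proof.
move=> mV iV2 indV Vv Vb.
have iV i : integrableR P (V i) by exact: integrable_of_sqr.
(* The spare [b ^+ 2] on the diagonal makes the bound uniform, so that the double sum is exactly n v
   + (n b)^2. *)
have iVV i j : integrableR P (fun w => V i w * V j w) /\
    \int[P]_w (V i w * V j w) <= (i == j)%:R * v + b ^+ 2.
  have [<-|ij] := eqVneq i j.
    rewrite mul1r; split; first exact: iV2.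
    by rewrite (le_trans (Vv i))// lerDl sqr_ge0.
  have [? ->] := independent_expectation (indV _ _ ij) (iV i) (iV j).
  split=> //; rewrite mul0r add0r expr2 (le_trans (ler_norm _))// normrM.
  exact: ler_pM.
have -> : (fun w => (\sum_i V i w) ^+ 2) = fun w => \sum_i \sum_j V i w * V j w.
  by apply/funext => w; rewrite expr2 big_distrlr.
have iS i : integrableR P (fun w => \sum_j V i w * V j w).
  by apply: integrable_bigsum => j; exact: (iVV i j).1.
split; first exact: integrable_bigsum.
rewrite Rintegral_bigsum//.
apply: (@le_trans _ _ (\sum_(i < n) \sum_(j < n) ((i == j)%:R * v + b ^+ 2))).
  apply: ler_sum => i _; rewrite Rintegral_bigsum; last by move=> j; exact: (iVV i j).1.
  by apply: ler_sum => j _; exact: (iVV i j).2.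
rewrite le_eqVlt; apply/orP; left; apply/eqP.
transitivity (\sum_(i < n) (v + n%:R * b ^+ 2)).
  apply: eq_bigr => i _; rewrite big_split/= sumr_const card_ord; congr (_ + _); last first.
    by rewrite mulr_natl.
  rewrite (bigD1 i)//= eqxx mul1r big1 ?addr0// => j ji.
  by rewrite eq_sym (negbTE ji) mul0r.
by rewrite sumr_const card_ord -mulr_natl; ring.
Qed.
End second_moment.

(** * Moments of the noise *)

Section normal.
Context (R : realType).

(** The Radon-Nikodym derivative agrees with the density only almost everywhere, so the integrands
    are compared almost everywhere. *)
Lemma ge0_integral_normal_prob (s : R) (f : R -> \bar R) : (0 < s) ->
  measurable_fun setT f -> (forall y, 0 <= f y)%E ->
  (\int[normal_prob 0 s]_y f y =
   \int[lebesgue_measure]_y (f y * (normal_pdf 0 s y)%:E))%E.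
Proof.
move=> s0 mf f0; have dom := normal_prob_dominates 0 s.
rewrite -(Radon_Nikodym_SigmaFinite.change_of_variables dom)//.
have iRN := Radon_Nikodym_SigmaFinite.f_integrable dom.
have mpdf : measurable_fun setT (fun y => (normal_pdf 0 s y)%:E).
  by apply/measurable_EFinP; exact: measurable_normal_pdf.
apply: ge0_ae_eq_integral => //.
- by apply: emeasurable_funM => //; exact: measurable_int iRN.
- exact: emeasurable_funM.
- by move=> y _; rewrite mule_ge0// Radon_Nikodym_SigmaFinite.f_ge0.
- by move=> y _; rewrite mule_ge0// lee_fin normal_pdf_ge0.
apply: ae_eqe_mul2l; apply: integral_ae_eq => // E _ mE.
by rewrite -Radon_Nikodym_SigmaFinite.f_integral.
Qed.

Lemma normal_probN (s : R) (A : set R) : s != 0 -> measurable A ->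
  normal_prob 0 s [set y | A (- y)] = normal_prob 0 s A.
Proof.
move=> s0 mA; rewrite /normal_prob.
have mN : measurable_fun setT (-%R : R -> measurableTypeR R) by exact: oppr_measurable.
rewrite [RHS](@eq_measure_integral _ _ _ _
    (pushforward lebesgue_measure (-%R : R -> measurableTypeR R))); last first.
  by move=> B mB _; exact/esym/lebesgue_measureN.
rewrite ge0_integral_pushforward//.
- apply: eq_integral => y _ /=; congr (_%:E).
  by rewrite !normal_pdfE// /normal_fun !subr0 sqrrN.
- by apply/measurable_EFinP/measurable_funTS; exact: measurable_normal_pdf.
- by move=> y _; rewrite lee_fin normal_pdf_ge0.
Qed.

(* [y^2 exp (- y^2 / (2 s^2)) <= 4 s^2 exp (- y^2 / (4 s^2))], the density of a
   wider normal law up to a constant. *)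
Lemma normal_second_moment (s : R) : 0 < s ->
  exists2 C : R, 0 <= C & (\int[normal_prob 0 s]_y (y ^+ 2)%:E <= C%:E)%E.
Proof.
move=> s0; have s0' : s != 0 by rewrite gt_eqF.
pose t := s * Num.sqrt 2.
have t0 : t != 0 by rewrite mulf_neq0// gt_eqF// sqrtr_gt0.
have tE : t ^+ 2 = 2 * s ^+ 2 by rewrite exprMn sqr_sqrtr// mulrC.
have pt0 := normal_peak_gt0 t0; have ps0 := normal_peak_gt0 s0'.
pose C := 4 * s ^+ 2 * normal_peak s / normal_peak t.
have C0 : 0 <= C.
  by rewrite divr_ge0 ?(ltW pt0)// mulr_ge0 ?(ltW ps0)// mulr_ge0// sqr_ge0.
exists C => //.
rewrite ge0_integral_normal_prob//.
- rewrite -[leRHS]mule1 -(integral_normal_pdf 0 t) -ge0_integralZl//; last 2 first.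
  + by apply/measurable_EFinP; exact: measurable_normal_pdf.
  + by move=> y _; rewrite lee_fin normal_pdf_ge0.
  apply: ge0_le_integral => //.
  + by move=> y _; rewrite mule_ge0 ?lee_fin ?sqr_ge0 ?normal_pdf_ge0.
  + apply: emeasurable_funM; apply/measurable_EFinP; last exact: measurable_normal_pdf.
    exact: exprn_measurable.
  + apply: emeasurable_funM => //; apply/measurable_EFinP; exact: measurable_normal_pdf.
  + move=> y _; rewrite -!EFinM lee_fin !normal_pdfE//.
    rewrite /normal_fun subr0 tE /C.
    pose u := y ^+ 2 / (4 * s ^+ 2).
    have u0 : 0 <= u by rewrite divr_ge0 ?sqr_ge0// mulr_ge0// sqr_ge0.
    have -> : - y ^+ 2 / (s ^+ 2 *+ 2) = - u - u by rewrite /u; field.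
    have -> : - y ^+ 2 / ((2 * s ^+ 2) *+ 2) = - u by rewrite /u; field.
    rewrite expRD.
    have yE : y ^+ 2 = 4 * s ^+ 2 * u by rewrite /u; field.
    have uu : u * expR (- u) <= 1.
      by rewrite expRN ler_pdivrMr ?expR_gt0// mul1r (le_trans _ (expR_ge1Dx u))// lerDr.
    rewrite yE.
    have -> : 4 * s ^+ 2 * normal_peak s / normal_peak t * (normal_peak t * expR (- u)) =
      4 * s ^+ 2 * normal_peak s * expR (- u) * 1 by field; rewrite gt_eqF.
    have -> : 4 * s ^+ 2 * u * (normal_peak s * (expR (- u) * expR (- u))) =
      4 * s ^+ 2 * normal_peak s * expR (- u) * (u * expR (- u)) by ring.
    by rewrite ler_wpM2l// !mulr_ge0 ?(ltW s0) ?(ltW ps0) ?expR_ge0.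
- by apply/measurable_EFinP; exact: exprn_measurable.
- by move=> y; rewrite lee_fin sqr_ge0.
Qed.

Lemma centered_normalN (s : R) (A : set R) : measurable A ->
  centered_normal s [set y | A (- y)] = centered_normal s A.
Proof.
rewrite /centered_normal; case: ifPn => s0 mA; last exact: normal_probN.
by rewrite !diracE; congr ((_ : bool)%:R%:E); apply/idP/idP; rewrite !inE/= oppr0.
Qed.

(** [C] is quantified before the probability space, because the constants of the theorem must not
    depend on that space. *)
Lemma centered_normal_moments (s : R) : 0 <= s ->
  exists2 C : R, 0 <= C &
  forall (disp : measure_display) (T : measurableType disp)
    (P : probability T R) (eps : {RV P >-> R}),
    (forall A, measurable A -> distribution P eps A = centered_normal s A) ->
  [/\ integrableR P (fun w => eps w ^+ 2), \int[P]_w (eps w ^+ 2) <= C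
     & \int[P]_w eps w = 0].
Proof.
move=> s0.
have msq : measurable_fun setT (fun y : R => (y ^+ 2)%:E).
  by apply/measurable_EFinP; exact: exprn_measurable.
have [C C0 HC] : exists2 C : R, 0 <= C &
    forall (disp : measure_display) (T : measurableType disp)
    (P : probability T R) (eps : {RV P >-> R}),
    (forall A, measurable A -> distribution P eps A = centered_normal s A) ->
    (\int[P]_w (eps w ^+ 2)%:E <= C%:E)%E.
  have [->|s1] := eqVneq s 0.
    exists 0 => // disp T P eps.
    rewrite /centered_normal eqxx => Peps.
    rewrite -(ge0_integral_distribution eps msq); last by move=> y; rewrite lee_fin sqr_ge0.
    rewrite (@eq_measure_integral _ _ _ _ (\d_(0 : R))); last by move=> A mA _; exact: Peps.
    by rewrite integral_dirac// expr0n mule0.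
  have sgt0 : 0 < s by rewrite lt_neqAle eq_sym s1.
  have [C C0 HC] := normal_second_moment sgt0; exists C => // disp T P eps.
  rewrite /centered_normal (negbTE s1) => Peps.
  rewrite -(ge0_integral_distribution eps msq); last by move=> y; rewrite lee_fin sqr_ge0.
  apply: le_trans HC; rewrite le_eqVlt; apply/orP; left; apply/eqP.
  have mid : @measurable_fun _ _ (measurableTypeR R) R setT id by move=> _ A mA; rewrite setTI.
  pose idR : {mfun (measurableTypeR R) >-> R} :=
    HB.pack (id : measurableTypeR R -> R) (isMeasurableFun.Build _ _ _ _ _ mid).
  transitivity (\int[distribution (normal_prob 0 s) idR]_y (y ^+ 2)%:E)%E.
    by apply: eq_measure_integral => A mA _; exact: Peps.
  by rewrite ge0_integral_distribution// => y; rewrite lee_fin sqr_ge0.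
exists C => // disp T P eps Peps.
have i2 : integrableR P (fun w => eps w ^+ 2).
  apply/integrableP; split.
    by apply/measurable_EFinP; exact: measurable_funX.
  apply: (@le_lt_trans _ _ C%:E); last exact: ltry.
  apply: le_trans (HC _ _ _ _ Peps); rewrite le_eqVlt; apply/orP; left; apply/eqP.
  by apply: eq_integral => w _ /=; rewrite ger0_norm// sqr_ge0.
split=> //; first by rewrite -lee_fin EFin_Rintegral//; exact: HC.
have meps : measurable_fun setT (fun w => eps w) by [].
have i1 : integrableR P (fun w => eps w) by exact: integrable_of_sqr.
have mN : measurable_fun setT (fun w => - eps w) by exact: measurable_funN.
pose N : {RV P >-> R} := HB.pack (fun w => - eps w) (isMeasurableFun.Build _ _ _ _ _ mN).
have iN : integrableR P (fun w => -1 * eps w) by exact: integrable_scale.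
(* By symmetry [eps] and [- eps] have the same law, so the mean equals its own opposite; no integral
   against the density is computed. *)
have : \int[P]_w eps w = \int[P]_w (-1 * eps w).
  have -> : (fun w => -1 * eps w) = N by apply/funext => w; rewrite mulN1r.
  rewrite /Rintegral; congr fine.
  transitivity (\int[distribution P eps]_y y%:E)%E.
    by rewrite integral_distribution.
  transitivity (\int[distribution P N]_y y%:E)%E; last first.
    rewrite integral_distribution//.
    by apply: eq_integrable iN => // w _ /=; rewrite mulN1r.
  apply: eq_measure_integral => A mA _.
  transitivity (centered_normal s A); first exact: Peps.
  rewrite -centered_normalN//; apply/esym/(Peps [set y | A (- y)]).
  by rewrite -[X in measurable X]setTI; exact: (@oppr_measurable R setT).
by rewrite RintegralZl//; lra.
Qed.

End normal.

(** * Conditioning on finitely many cells *)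

Section finite_codes.
Context (R : realType) (disp : measure_display) (T : measurableType disp).

(** A function of a finite code takes finitely many values, on measurable fibres. The kernel, the
    weights and their quotients are all measurable for this reason. *)
Lemma measurable_fun_code (F : finType) (c : T -> F) (phi : F -> R) :
  (forall b, measurable (c @^-1` [set b])) ->
  measurable_fun setT (fun w => phi (c w)).
Proof.
move=> mc _ A mA; rewrite setTI.
have -> : (fun w => phi (c w)) @^-1` A =
    \bigcup_(b in [set b | A (phi b)]) (c @^-1` [set b]).
  by apply/seteqP; split=> w /=; [move=> Aw; exists (c w)|case=> b Ab ->].
by apply: fin_bigcup_measurable => //; exact: finite_finset.
Qed.

Lemma measurable_code_family (I F : finType) (c : I -> T -> F) (v : {ffun I -> F}) :
  (forall i b, measurable (c i @^-1` [set b])) ->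
  measurable ((fun w => [ffun i => c i w]) @^-1` [set v]).
Proof.
move=> mc.
have -> : (fun w => [ffun i => c i w]) @^-1` [set v] =
    \bigcap_(i in [set: I]) (c i @^-1` [set v i]).
  apply/seteqP; split=> w /=.
    by move=> /ffunP H i _ /=; have := H i; rewrite ffunE.
  by move=> H; apply/ffunP => i; rewrite ffunE; exact: H.
by apply: fin_bigcap_measurable => //; exact: finite_finset.
Qed.

End finite_codes.

Section independence.
Context (R : realType) (disp : measure_display) (T : measurableType disp)
  (P : probability T R).

Lemma independent2_comp (d1 d2 d3 d4 : measure_display)
    (T1 : measurableType d1) (T2 : measurableType d2)
    (T3 : measurableType d3) (T4 : measurableType d4)
    (U : T -> T1) (V : T -> T2) (f : T1 -> T3) (g : T2 -> T4) :
  measurable_fun setT f -> measurable_fun setT g -> independent2 P U V ->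
  independent2 P (fun w => f (U w)) (fun w => g (V w)).
Proof.
move=> mf mg UV A B mA mB; apply: (UV (f @^-1` A) (g @^-1` B)).
  by rewrite -[X in measurable X]setTI; exact: mf.
by rewrite -[X in measurable X]setTI; exact: mg.
Qed.

Lemma independent2_indic (d1 : measure_display) (T1 : measurableType d1)
    (E : set T) (V : T -> T1) :
  measurable E -> measurable_fun setT V ->
  (forall B, measurable B -> P (E `&` V @^-1` B) = (P E * P (V @^-1` B))%E) ->
  independent2 P (\1_E : T -> R) V.
Proof.
move=> mE mV EV A B mA mB; rewrite preimage_indic.
have mVB : measurable (V @^-1` B) by rewrite -[X in measurable X]setTI; exact: mV.
case: ifPn => _; case: ifPn => _.
- by rewrite setTI probability_setT mul1e.
- exact: EV.
- have -> : P (~` E `&` V @^-1` B) = (P (V @^-1` B) - P (E `&` V @^-1` B))%E.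
    rewrite setIC -setDE measureD//; first by rewrite setIC.
    by rewrite (le_lt_trans (probability_le1 P mVB))// ltry.
  by rewrite EV// probability_setC// muleBl ?mul1e// fin_num_measure.
- by rewrite set0I measure0 mul0e.
Qed.

Context (d1 : measure_display) (T1 : measurableType d1) (n : nat)
  (Z : 'I_n -> T -> T1).
Hypothesis mZ : forall i, measurable_fun setT (Z i).
Hypothesis indZ : mutually_independent P Z.

Lemma mutually_independent_pair (i j : 'I_n) : i != j -> independent2 P (Z i) (Z j).
Proof.
move=> ij A B mA mB.
pose C l := if l == i then A else B.
have mC l : measurable (C l) by rewrite /C; case: ifP.
have := indZ [set i; j]%SET mC.
have ij' : i \notin [set j]%SET by rewrite finset.in_set1.
rewrite (big_setU1 _ ij') big_set1 /C eqxx eq_sym (negbTE ij) => <-; congr (P _).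
apply/seteqP; split=> w /=.
  move=> [Aw Bw] l; rewrite /= finset.in_set2 => /orP[] /eqP ->; first by rewrite eqxx.
  by rewrite eq_sym (negbTE ij).
move=> H; split.
  by have := H i; rewrite /= finset.in_set2 eqxx => /(_ isT).
by have := H j; rewrite /= finset.in_set2 eqxx orbT eq_sym (negbTE ij) => /(_ isT).
Qed.

Lemma mutually_independent_others (i : 'I_n) (A : 'I_n -> set T1) (B : set T1) :
  (forall l, measurable (A l)) -> measurable B ->
  P ((\bigcap_(l in [set l | l != i]) Z l @^-1` A l) `&` Z i @^-1` B) =
  (P (\bigcap_(l in [set l | l != i]) Z l @^-1` A l) * P (Z i @^-1` B))%E.
Proof.
move=> mA mB.
pose C l := if l == i then B else A l.
have mC l : measurable (C l) by rewrite /C; case: ifP.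
have CA l : l != i -> C l = A l by rewrite /C => /negbTE ->.
have Ci : C i = B by rewrite /C eqxx.
have := indZ [set: 'I_n]%SET mC; have := indZ [set~ i]%SET mC.
rewrite [in X in _ -> X -> _](bigD1 i) ?finset.in_setT//= => E1 E2.
have -> : (\bigcap_(l in [set l | l != i]) Z l @^-1` A l) `&` Z i @^-1` B =
    \bigcap_(l in [set l | l \in [set: 'I_n]%SET]) Z l @^-1` C l.
  apply/seteqP; split=> w /=.
    move=> [H Bw] l _ /=; have [->|li] := eqVneq l i; first by rewrite Ci.
    by rewrite CA//; exact: H.
  move=> H; split; last by rewrite -Ci; apply: H => /=; rewrite finset.in_setT.
  by move=> l /= li; rewrite -CA//; apply: H => /=; rewrite finset.in_setT.
have -> : \bigcap_(l in [set l | l != i]) Z l @^-1` A l =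
    \bigcap_(l in [set l | l \in [set~ i]%SET]) Z l @^-1` C l.
  apply/seteqP; split=> w /= H l /=.
    by rewrite finset.in_setC1 => li; rewrite CA//; exact: H.
  by move=> li; rewrite -CA//; apply: H; rewrite /= finset.in_setC1.
rewrite E1 E2 Ci muleC; congr (_ * _)%E; apply: eq_bigl => l.
by rewrite finset.in_setC1 finset.in_setT.
Qed.

(* Conditionally on the codes of the other variables only the code of [Z i]
   matters: expand over the finitely many values of all the codes. *)
Lemma code_conditioning (F : finType) (c : T1 -> F) (u : T1 -> R) (C : R)
    (Phi : {ffun 'I_n -> F} -> R) (i : 'I_n) :
  (forall b, measurable (c @^-1` [set b])) ->
  measurable_fun setT u -> (forall z, 0 <= u z) -> (forall v, 0 <= Phi v) ->
  integrableR P (fun w => u (Z i w)) ->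
  (forall b, \int[P]_w ((c (Z i w) == b)%:R * u (Z i w)) <=
     C * \int[P]_w (c (Z i w) == b)%:R) ->
  integrableR P (fun w => Phi [ffun l => c (Z l w)] * u (Z i w)) /\
  \int[P]_w (Phi [ffun l => c (Z l w)] * u (Z i w)) <=
    C * \int[P]_w Phi [ffun l => c (Z l w)].
Proof.
move=> mc mu u0 Phi0 iu Hu.
pose E (v : {ffun 'I_n -> F}) :=
  \bigcap_(l in [set l | l != i]) Z l @^-1` (c @^-1` [set v l]).
pose e v : T -> R := \1_(E v).
pose f (v : {ffun 'I_n -> F}) w : R := (c (Z i w) == v i)%:R.
(* Only the [v] equal to the actual family of codes contributes. [e v] tests the codes of the other
   variables and [f v] that of [Z i], so [e v] is independent of [f v] and of [f v] times [u]. *)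
have PhiE w : Phi [ffun l => c (Z l w)] = \sum_v Phi v * (e v w * f v w).
  rewrite (bigD1 [ffun l => c (Z l w)])//= big1 ?addr0.
    rewrite /e /f indicE mem_set ?ffunE ?eqxx ?mulr1//.
    by move=> l _ /=; rewrite ffunE.
  move=> v vw; rewrite /e /f indicE.
  case: (boolP (w \in E v)) => [|_]; last by rewrite mul0r mulr0.
  rewrite inE => Ew; case: eqP => [fw|_]; last by rewrite !mulr0.
  case/negP: vw; apply/eqP/ffunP => l; rewrite ffunE.
  by have [->//|li] := eqVneq l i; rewrite (Ew l).
have mE v : measurable (E v).
  apply: fin_bigcap_measurable; first exact: finite_finset.
  by move=> l _; rewrite -[X in measurable X]setTI; exact: mZ.
have indE v : independent2 P (e v) (Z i).
  apply: independent2_indic => // B mB.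
  exact: (mutually_independent_others i (A := fun l => c @^-1` [set v l])).
have mf b : measurable_fun setT (fun z => (c z == b)%:R : R).
  exact: (measurable_fun_code (fun a => (a == b)%:R)).
have ie v : integrableR P (e v).
  apply: (@integrable_bounded _ _ _ P 1); first exact: measurable_indic.
  by move=> w; rewrite ger0_norm /e indicE; case: (_ \in _).
have if_ v : integrableR P (f v).
  apply: (@integrable_bounded _ _ _ P 1).
    exact: (measurableT_comp (mf (v i)) (mZ i)).
  by move=> w; rewrite /f; case: eqP => _; rewrite ?normr1// normr0.
have ifu v : integrableR P (fun w => f v w * u (Z i w)).
  apply: (integrable_le _ iu) => [|w].
    apply: measurable_funM; last exact: (measurableT_comp mu (mZ i)).
    exact: (measurableT_comp (mf (v i)) (mZ i)).
  by rewrite /f; case: eqP => _; rewrite ?mul1r ?mul0r ?normr0// ger0_norm.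
have [I1 E1] : (forall v, integrableR P (fun w => e v w * f v w)) /\
    forall v, \int[P]_w (e v w * f v w) = \int[P]_w e v w * \int[P]_w f v w.
  by split=> v; have [] := independent_expectation
    (independent2_comp (@measurable_id _ _ _) (mf (v i)) (indE v)) (ie v) (if_ v).
have [I2 E2] : (forall v, integrableR P (fun w => e v w * (f v w * u (Z i w)))) /\
    forall v, \int[P]_w (e v w * (f v w * u (Z i w))) =
      \int[P]_w e v w * \int[P]_w (f v w * u (Z i w)).
  by split=> v; have [] := independent_expectation
    (independent2_comp (@measurable_id _ _ _)
      (measurable_funM (mf (v i)) mu) (indE v)) (ie v) (ifu v).
have -> : (fun w => Phi [ffun l => c (Z l w)] * u (Z i w)) =
    fun w => \sum_v Phi v * (e v w * (f v w * u (Z i w))).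
  by apply/funext => w; rewrite PhiE mulr_suml; apply: eq_bigr => v _; rewrite !mulrA.
have -> : (fun w => Phi [ffun l => c (Z l w)]) =
    fun w => \sum_v Phi v * (e v w * f v w) by apply/funext => w; exact: PhiE.
split; first by apply: integrable_bigsum => v; exact: integrable_scale.
rewrite !Rintegral_bigsum; [|by move=> v; exact: integrable_scale..].
rewrite mulr_sumr; apply: ler_sum => v _.
rewrite !RintegralZl// mulrCA ler_wpM2l// E1 E2 mulrCA ler_wpM2l//; last exact: Hu.
by apply: Rintegral_ge0 => w _; rewrite /e indicE.
Qed.

End independence.

(** * The centered kernel *)

Section cells.
Context (R : realType).
Implicit Types (q : nat) (t : R).

Lemma cell_index_ge1 q t : 1 <= cell_index q t.
Proof. by rewrite /cell_index le_max lexx. Qed.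

(** The maximum with 1 makes the first cell unbounded below, hence the exceptional case [c == 1]. *)
Lemma cell_index_eq q t (c : int) : 1 <= c ->
  (cell_index q t == c) = ((c == 1) || ((c - 1)%:~R < 2 ^+ q * t)) && (2 ^+ q * t <= c%:~R).
Proof.
move=> c1; rewrite /cell_index; set y := 2 ^+ q * t.
have [->|cn1] /= := eqVneq c 1.
  by rewrite eq_maxl real_ceil_le_int ?num_real.
have c2 : 1 < c by rewrite lt_neqAle eq_sym cn1.
rewrite -real_ceil_le_int ?num_real// -real_ceil_gt_int ?num_real//; lia.
Qed.

Lemma cell_index_bounds q t : 0 <= t ->
  (cell_index q t)%:~R - 1 <= 2 ^+ q * t <= (cell_index q t)%:~R.
Proof.
move=> t0; have := cell_index_eq q t (cell_index_ge1 q t).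
rewrite eqxx => /esym/andP[H1 H2]; apply/andP; split=> //.
case/orP: H1 => [/eqP ->|]; first by rewrite subrr mulr_ge0// exprn_ge0.
by rewrite intrD => /ltW.
Qed.

Lemma cell_index_dist q s t : 0 <= s -> 0 <= t ->
  cell_index q s = cell_index q t -> `|s - t| <= (1 / 2) ^+ q.
Proof.
move=> s0 t0 st; have := cell_index_bounds q s0; have := cell_index_bounds q t0.
rewrite st => /andP[t1 t2] /andP[s1 s2].
rewrite div1r exprVn -[leRHS]mul1r ler_pdivlMr ?exprn_gt0//.
rewrite -[X in _ * X](@gtr0_norm _ (2 ^+ q)) ?exprn_gt0// -normrM mulrBl !(mulrC _ (2 ^+ q)).
by rewrite ler_norml; lra.
Qed.

Lemma cell_set q (c : int) : 1 <= c ->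
  [set t : R | cell_index q t = c] =
  [set` Interval (if c == 1 then -oo%O else BRight ((c - 1)%:~R / 2 ^+ q))
                 (BRight (c%:~R / 2 ^+ q))].
Proof.
move=> c1; have q0 : 0 < 2 ^+ q :> R by rewrite exprn_gt0.
apply/seteqP; split=> t /=.
  move/eqP; rewrite cell_index_eq// => /andP[H1 H2].
  rewrite /= itv_boundlr; apply/andP; split; last by rewrite bnd_simp ler_pdivlMr// mulrC.
  by case: ifP H1 => //= _ H1; rewrite bnd_simp ltr_pdivrMr// mulrC.
rewrite /= itv_boundlr => /andP[H1 H2]; apply/eqP; rewrite cell_index_eq//; apply/andP; split.
  by case: ifP H1 => //= _; rewrite bnd_simp ltr_pdivrMr// mulrC.
by move: H2; rewrite bnd_simp ler_pdivlMr// mulrC.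
Qed.

Lemma measurable_cell q (c : int) : 1 <= c -> measurable [set t : R | cell_index q t = c].
Proof. by move=> c1; rewrite cell_set//; exact: measurable_itv. Qed.

Lemma uniform_probE (A : set R) : measurable A ->
  uniform_prob (@ltr01 R) A = lebesgue_measure (A `&` `[0, 1]).
Proof.
move=> mA; rewrite /uniform_prob integral_uniform_pdf.
rewrite (eq_integral (fun=> 1%E)); last first.
  move=> y; rewrite inE => -[_]; rewrite /= in_itv/= => y01.
  by rewrite /uniform_pdf y01 subr0 invr1.
rewrite integral_cst ?mul1e//; exact: measurableI.
Qed.

Lemma uniform_prob_cell q t : 0 <= t <= 1 ->
  uniform_prob (@ltr01 R) [set s | cell_index q s = cell_index q t] = ((1 / 2) ^+ q)%:E.
Proof.
move=> /andP[t0 t1]; have c1 := cell_index_ge1 q t.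
have q0 : 0 < 2 ^+ q :> R by rewrite exprn_gt0.
rewrite uniform_probE; last exact: measurable_cell.
(* Here [t <= 1] enters: the cell of [t] ends at 1 or before, so intersecting with [0,1] removes
   nothing on the right. *)
have cq : (cell_index q t)%:~R <= 2 ^+ q :> R.
  rewrite /cell_index; have -> : 2 ^+ q = (2 ^+ q)%:~R :> R by rewrite rmorphXn.
  rewrite ler_int ge_max exprn_ege1//= real_ceil_le_int ?num_real// rmorphXn/=.
  by rewrite ler_piMr// ltW.
set c := cell_index q t in c1 cq *.
have [c11|cn1] := eqVneq c 1.
  have -> : [set s : R | cell_index q s = c] `&` `[0, 1] = `[0, 1 / 2 ^+ q]%classic.
    rewrite cell_set// c11/=; apply/seteqP; split=> s /=; rewrite !in_itv/=.
      by case=> -> /andP[->].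
    move=> /andP[-> sq]; split=> //=; rewrite (le_trans sq)// ler_pdivrMr// mul1r.
    by rewrite exprn_ege1// ler1n.
  by rewrite lebesgue_measure_itv/= lte_fin divr_gt0// oppr0 adde0 !div1r exprVn.
have -> : [set s : R | cell_index q s = c] `&` `[0, 1] =
    `](c - 1)%:~R / 2 ^+ q, c%:~R / 2 ^+ q]%classic.
  rewrite cell_set// (negbTE cn1); apply/seteqP; split=> s /=; rewrite !in_itv/=.
    by case.
  move=> /andP[H1 H2]; rewrite H1 H2; split=> //; apply/andP; split.
    by apply/ltW/(le_lt_trans _ H1); rewrite divr_ge0 ?(ltW q0)// ler0z subr_ge0.
  by rewrite (le_trans H2)// ler_pdivrMr// mul1r.
rewrite lebesgue_measure_itv/= lte_fin ltr_pM2r ?invr_gt0// ltr_int ltrBlDr ltrDl ltr01.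
rewrite -EFinB; congr (_%:E); rewrite intrB -mulrBl div1r exprVn.
by rewrite opprB addrC subrK mul1r.
Qed.

End cells.

Section kernel.
Context (R : realType) (d : nat) (x : d.-tuple R).

Definition same_cells (q : 'I_d -> nat) (z : d.-tuple R) : R :=
  \prod_(j < d) (cell_index (q j) (tnth x j) == cell_index (q j) (tnth z j))%:R.

Lemma same_cells_ge0 q z : 0 <= same_cells q z.
Proof. by apply: prodr_ge0. Qed.

Lemma centered_kernelE k z : centered_kernel k x z =
  \sum_(f : {ffun 'I_d -> 'I_k.+1} | (\sum_j f j)%N == k)
    multinomial_weight R f * same_cells (fun j => f j) z.
Proof. by []. Qed.

Lemma centered_kernel_ge0 k z : 0 <= centered_kernel k x z.
Proof.
rewrite centered_kernelE; apply: sumr_ge0 => f _.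
by rewrite mulr_ge0 ?multinomial_weight_ge0 ?same_cells_ge0.
Qed.

Definition cell_rectangle (q : 'I_d -> nat) : set (d.-tuple R) :=
  [set z | forall j, cell_index (q j) (tnth z j) = cell_index (q j) (tnth x j)].

Lemma same_cellsE q z : same_cells q z = \1_(cell_rectangle q) z.
Proof.
rewrite indicE; case: (boolP (z \in _)) => [|]; rewrite ?inE.
  by move=> H; apply: big1 => j _; rewrite H eqxx.
rewrite notin_setE/= => H.
have [j] : exists j, cell_index (q j) (tnth z j) <> cell_index (q j) (tnth x j).
  by apply/existsNP.
by move/eqP; rewrite eq_sym /same_cells (bigD1 j)//= => /negbTE ->; rewrite mul0r.
Qed.

Lemma measurable_cell_rectangle q : measurable (cell_rectangle q).
Proof.
have -> : cell_rectangle q = \bigcap_(j in [set: 'I_d]) ((@tnth d R)^~ j @^-1`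
    [set s | cell_index (q j) s = cell_index (q j) (tnth x j)]).
  by apply/seteqP; split=> z /= H j; [move=> _; exact: H|exact: (H j)].
apply: fin_bigcap_measurable; first exact: finite_finset.
move=> j _; rewrite -[X in measurable X]setTI.
by apply: measurable_tnth => //; apply: measurable_cell; exact: cell_index_ge1.
Qed.

Lemma measurable_same_cells q : measurable_fun setT (same_cells q).
Proof.
rewrite (_ : same_cells q = \1_(cell_rectangle q)).
  by apply: measurable_indic; exact: measurable_cell_rectangle.
by apply/funext => z; rewrite same_cellsE.
Qed.

(** All that the kernel of depth [k] sees of [z], encoded by finitely many booleans so that
    conditioning on it is a finite sum. *)
Definition cell_code k (z : d.-tuple R) : {ffun 'I_d * 'I_k.+1 -> bool} :=
  [ffun p : 'I_d * 'I_k.+1 => cell_index p.2 (tnth z p.1) == cell_index p.2 (tnth x p.1)].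

Definition kernel_of_code k (b : {ffun 'I_d * 'I_k.+1 -> bool}) : R :=
  \sum_(f : {ffun 'I_d -> 'I_k.+1} | (\sum_j f j)%N == k)
    multinomial_weight R f * \prod_(j < d) (b (j, f j))%:R.

Lemma kernel_of_codeE k z : kernel_of_code (cell_code k z) = centered_kernel k x z.
Proof.
apply: eq_bigr => f _; congr (_ * _); apply: eq_bigr => j _.
by rewrite ffunE eq_sym.
Qed.

Lemma measurable_cell_code k b : measurable (cell_code k @^-1` [set b]).
Proof.
apply: measurable_code_family => -[j q] b' /=.
have m1 : measurable [set z : d.-tuple R | cell_index q (tnth z j) = cell_index q (tnth x j)].
  rewrite -[X in measurable X]setTI.
  exact: (measurable_tnth j measurableT (measurable_cell q (cell_index_ge1 q (tnth x j)))).
case: b'.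
  rewrite (_ : _ @^-1` _ = [set z : d.-tuple R | cell_index q (tnth z j) = cell_index q (tnth x j)])//.
  by apply/seteqP; split=> z /= /eqP.
rewrite (_ : _ @^-1` _ = ~` [set z : d.-tuple R | cell_index q (tnth z j) = cell_index q (tnth x j)]).
  exact: measurableC.
by apply/seteqP; split=> z /=; [move/negbT/eqP|move/eqP/negbTE].
Qed.

Lemma measurable_centered_kernel k : measurable_fun setT (centered_kernel k x).
Proof.
have -> : centered_kernel k x = fun z => kernel_of_code (cell_code k z).
  by apply/funext => z; rewrite kernel_of_codeE.
by apply: measurable_fun_code => b; exact: measurable_cell_code.
Qed.

Hypothesis xc : unit_cube x.

(** Of the two cell indicators in a coordinate the deeper one is kept and the other bounded by 1;
    dyadic cells being nested, nothing is lost. *)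
Lemma centered_kernel_sqr_le k z : centered_kernel k x z ^+ 2 <=
  \sum_(f : {ffun 'I_d -> 'I_k.+1} | (\sum_j f j)%N == k)
  \sum_(g : {ffun 'I_d -> 'I_k.+1} | (\sum_j g j)%N == k)
    multinomial_weight R f * multinomial_weight R g *
    same_cells (fun j => maxn (f j) (g j)) z.
Proof.
rewrite centered_kernelE expr2 mulr_suml; apply: ler_sum => f _.
rewrite mulr_sumr; apply: ler_sum => g _.
rewrite mulrACA; apply: ler_wpM2l; first by apply: mulr_ge0; exact: multinomial_weight_ge0.
rewrite /same_cells -big_split/=; apply: ler_prod => j _.
rewrite mulr_ge0//=; case: (leqP (f j) (g j)) => _.
  by rewrite ler_piMl//; case: (_ == _).
by rewrite ler_piMr//; case: (_ == _).
Qed.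

Lemma centered_kernel_dist_le k z j : unit_cube z ->
  centered_kernel k x z * `|tnth x j - tnth z j| <=
  \sum_(f : {ffun 'I_d -> 'I_k.+1} | (\sum_j f j)%N == k)
    multinomial_weight R f * (1 / 2) ^+ f j * same_cells (fun j => f j) z.
Proof.
move=> zc; rewrite centered_kernelE mulr_suml; apply: ler_sum => f _.
move: (multinomial_weight R f) (multinomial_weight_ge0 R f) => p p0.
rewrite -!mulrA ler_wpM2l// /same_cells (bigD1 j)//=.
have [e|_] := eqVneq (cell_index (f j) (tnth x j)) (cell_index (f j) (tnth z j)); last first.
  by rewrite /= !(mul0r, mulr0).
rewrite /= mulrC; apply: ler_wpM2r; first by rewrite mul1r prodr_ge0.
by case/andP: (xc j) (zc j) => x0 _ /andP[z0 _]; exact: cell_index_dist x0 z0 e.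
Qed.

Context (disp : measure_display) (T : measurableType disp) (P : probability T R)
  (X : {RV P >-> d.-tuple R}).
Hypothesis uX : uniform_on_cube P X.

Lemma integrable_same_cells q : integrableR P (fun w => same_cells q (X w)).
Proof.
apply: (@integrable_bounded _ _ _ P 1).
  exact: (measurableT_comp (measurable_same_cells q)).
move=> w; rewrite same_cellsE indicE; case: (_ \in _); rewrite ?normr1// normr0//.
Qed.

Lemma same_cells_mean q :
  \int[P]_w same_cells q (X w) = \prod_(j < d) (1 / 2) ^+ q j.
Proof.
apply: EFin_inj; rewrite EFin_Rintegral; last exact: integrable_same_cells.
transitivity (\int[P]_w (\1_(X @^-1` cell_rectangle q) w)%:E)%E.
  by apply: eq_integral => w _; rewrite same_cellsE.
rewrite integral_indic//; last first.
  by rewrite -[X in measurable X]setTI; apply: measurable_funPT => //; exact: measurable_cell_rectangle.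
pose B j := [set s : R | cell_index (q j) s = cell_index (q j) (tnth x j)].
have mB j : measurable (B j) by apply: measurable_cell; exact: cell_index_ge1.
rewrite setIT; apply: etrans (uX.2 B mB) _.
by rewrite -prodEFin; apply: eq_bigr => j _; rewrite uniform_prob_cell.
Qed.

(** The kernel and the dominating functions for its square and for its product with a distance are
    all combinations of this form; the levels [q f] are maxima of two splits in the case of the
    square. *)
Lemma Rintegral_cells_sum (F : finType) (p : pred F) (a : F -> R) (q : F -> 'I_d -> nat) :
  integrableR P (fun w => \sum_(f | p f) a f * same_cells (q f) (X w)) /\
  \int[P]_w (\sum_(f | p f) a f * same_cells (q f) (X w)) =
  \sum_(f | p f) a f * \prod_(j < d) (1 / 2) ^+ q f j.
Proof.
have E w : \sum_(f | p f) a f * same_cells (q f) (X w) =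
   \sum_f (if p f then a f else 0) * same_cells (q f) (X w).
  by rewrite big_mkcond; apply: eq_bigr => f _; case: ifP; rewrite ?mul0r.
have i f : integrableR P (fun w => (if p f then a f else 0) * same_cells (q f) (X w)).
  by apply: integrable_scale; exact: integrable_same_cells.
have -> : (fun w => \sum_(f | p f) a f * same_cells (q f) (X w)) =
  fun w => \sum_f (if p f then a f else 0) * same_cells (q f) (X w) by apply/funext.
split; first exact: integrable_bigsum.
rewrite Rintegral_bigsum// [RHS]big_mkcond; apply: eq_bigr => f _.
rewrite RintegralZl ?same_cells_mean//; last exact: integrable_same_cells.
by case: ifP; rewrite ?mul0r.
Qed.

Lemma integrable_centered_kernel k : integrableR P (fun w => centered_kernel k x (X w)).
Proof.
have -> : (fun w => centered_kernel k x (X w)) = fun w =>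
    \sum_(f : {ffun 'I_d -> 'I_k.+1} | (\sum_j f j)%N == k)
      multinomial_weight R f * same_cells (fun j => f j) (X w).
  by apply/funext => w; rewrite centered_kernelE.
by have [] := Rintegral_cells_sum (fun f : {ffun 'I_d -> 'I_k.+1} => (\sum_j f j)%N == k)
  (fun f => multinomial_weight R f) (fun f j => f j).
Qed.

Lemma centered_kernel_mean k : (0 < d)%N ->
  \int[P]_w centered_kernel k x (X w) = (1 / 2) ^+ k.
Proof.
move=> d0; have [_] := Rintegral_cells_sum
  (fun f : {ffun 'I_d -> 'I_k.+1} => (\sum_j f j)%N == k)
  (fun f => multinomial_weight R f) (fun f j => f j).
move=> E; transitivity (\sum_(f : {ffun 'I_d -> 'I_k.+1} | (\sum_j f j)%N == k)
  multinomial_weight R f * \prod_(j < d) (1 / 2) ^+ f j); first exact: E.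
by rewrite multinomial_weight_sum sumr_const card_ord -[X in X / d%:R]mulr_natr mulfK// pnatr_eq0 -lt0n.
Qed.

Lemma centered_kernel_dist_mean k j : 
  \int[P]_w (\sum_(f : {ffun 'I_d -> 'I_k.+1} | (\sum_j f j)%N == k)
    multinomial_weight R f * (1 / 2) ^+ f j * same_cells (fun j => f j) (X w)) =
  (1 / 2) ^+ k * (1 - 1 / (2 * d%:R)) ^+ k.
Proof.
have d0 : d%:R != 0 :> R by rewrite pnatr_eq0 -lt0n (leq_ltn_trans _ (ltn_ord j)).
have [_ E] := Rintegral_cells_sum
  (fun f : {ffun 'I_d -> 'I_k.+1} => (\sum_j f j)%N == k)
  (fun f => multinomial_weight R f * (1 / 2) ^+ f j) (fun f j => f j).
rewrite {}E.
(* The cell volume is the constant 2^-k, and the remaining weight is (1/2)^(f j) at [j] and 1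
   elsewhere: the generating function is evaluated at mean (d - 1/2)/d. *)
transitivity (\sum_(f : {ffun 'I_d -> 'I_k.+1} | (\sum_j f j)%N == k)
  (1 / 2) ^+ k * (multinomial_weight R f * \prod_(i < d) (if i == j then 1 / 2 else 1) ^+ f i)).
  apply: eq_bigr => f /eqP fk; rewrite prodrXr fk mulrC; congr (_ * (_ * _)).
  rewrite (bigD1 j)//= eqxx big1 ?mulr1// => i ij.
  by rewrite (negbTE ij) expr1n.
rewrite -mulr_sumr multinomial_weight_sum; congr (_ * _ ^+ k).
rewrite (bigD1 j)//= eqxx (eq_bigr (fun=> 1)); last by move=> i /negbTE ->.
rewrite sumr_const; have -> : #|[pred i : 'I_d | i != j]| = d.-1 by rewrite cardC1 card_ord.
have -> : d.-1%:R = d%:R - 1 :> R.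
  by rewrite -subn1 natrB// (leq_ltn_trans _ (ltn_ord j)).
by field.
Qed.

Lemma integrable_centered_kernel_sqr k :
  integrableR P (fun w => centered_kernel k x (X w) ^+ 2).
Proof.
have [+ _] := Rintegral_cells_sum
  (fun p : {ffun 'I_d -> 'I_k.+1} * {ffun 'I_d -> 'I_k.+1} =>
     ((\sum_j p.1 j)%N == k) && ((\sum_j p.2 j)%N == k))
  (fun p => multinomial_weight R p.1 * multinomial_weight R p.2)
  (fun p j => maxn (p.1 j) (p.2 j)).
move=> ib; apply: (integrable_le _ ib) => [|w].
  apply: measurable_funX.
  exact: (measurableT_comp (measurable_centered_kernel k)).
rewrite ger0_norm ?sqr_ge0//; apply: (le_trans (centered_kernel_sqr_le _ _)).
by rewrite pair_big.
Qed.

Lemma centered_kernel_sqr_mean k : (0 < d)%N -> (0 < k)%N ->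
  \int[P]_w (centered_kernel k x (X w) ^+ 2) <=
  (1 / 2) ^+ k * (8 ^+ d * Num.sqrt (d%:R / k%:R) ^+ d.-1).
Proof.
move=> d0 k0; have [+ E] := Rintegral_cells_sum
  (fun p : {ffun 'I_d -> 'I_k.+1} * {ffun 'I_d -> 'I_k.+1} =>
     ((\sum_j p.1 j)%N == k) && ((\sum_j p.2 j)%N == k))
  (fun p => multinomial_weight R p.1 * multinomial_weight R p.2)
  (fun p j => maxn (p.1 j) (p.2 j)).
move=> i2; apply: le_trans (collision_weight_le R d0 k0).
rewrite [leRHS]pair_big/= -E; apply: le_Rintegral => //.
  exact: integrable_centered_kernel_sqr.
move=> w _; apply: (le_trans (centered_kernel_sqr_le _ _)).
by rewrite pair_big.
Qed.

End kernel.

(** * The risk of the estimator *)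

(** The variance of [u] under the weights [p] is nonnegative. *)
Lemma sqr_sum_weights_le (R : realFieldType) (n : nat) (p u : 'I_n -> R) :
  (forall i, 0 <= p i) -> \sum_i p i = 1 ->
  (\sum_i p i * u i) ^+ 2 <= \sum_i p i * u i ^+ 2.
Proof.
move=> p0 p1; set a := \sum_i p i * u i.
have : 0 <= \sum_i p i * (u i - a) ^+ 2.
  by apply: sumr_ge0 => i _; rewrite mulr_ge0// sqr_ge0.
have E b : \sum_i p i * (u i - b) ^+ 2 =
    \sum_i p i * u i ^+ 2 + (- (2 * b)) * \sum_i p i * u i + b ^+ 2 * \sum_i p i.
  rewrite !mulr_sumr -!big_split/=; apply: eq_bigr => i _; ring.
by rewrite E -/a p1; nra.
Qed.

Section regression.
Context (R : realType) (d : nat) (m : d.-tuple R -> R) (sigma M C : R)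
  (x : d.-tuple R).
Hypothesis mM : forall z, unit_cube z -> `|m z| <= M.
Hypothesis xc : unit_cube x.
Hypothesis epsC : forall (disp : measure_display) (T : measurableType disp)
    (P : probability T R) (eps : {RV P >-> R}),
    (forall A, measurable A -> distribution P eps A = centered_normal sigma A) ->
  [/\ integrableR P (fun w => eps w ^+ 2), \int[P]_w (eps w ^+ 2) <= C
     & \int[P]_w eps w = 0].

(** Comes from (m(X) - m(x) + eps)^2 <= 2 (2M)^2 + 2 eps^2. *)
Let D := 8 * M ^+ 2 + 2 * C.

Context (disp : measure_display) (T : measurableType disp) (P : probability T R).

(** Serves for [g] the squared kernel (numerator), the constant 1 (integrability) and the indicator
    of a code (conditioning). *)
Lemma regression_second_moment (X : {RV P >-> d.-tuple R}) (Y : {RV P >-> R})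
    (g : d.-tuple R -> R) :
  regression_pair m sigma X Y ->
  measurable_fun setT g -> (forall z, 0 <= g z <= 1) ->
  integrableR P (fun w => g (X w) * (Y w - m x) ^+ 2) /\
  \int[P]_w (g (X w) * (Y w - m x) ^+ 2) <= D * \int[P]_w g (X w).
Proof.
move=> [[Xc _] [eps [YE Leps indXe]]] mg g01.
have [i2 e2 e1] := epsC Leps.
have mgX : measurable_fun setT (fun w => g (X w)) by exact: measurableT_comp.
have ig : integrableR P (fun w => g (X w)).
  apply: (@integrable_bounded _ _ _ P 1) => // w.
  by case/andP: (g01 (X w)) => g0 g1; rewrite ger0_norm.
have [ige Ege] := independent_expectation
  (independent2_comp mg (@exprn_measurable R setT 2) indXe) ig i2.
have ib : integrableR P (fun w => 8 * M ^+ 2 * g (X w) + 2 * (g (X w) * eps w ^+ 2)).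
  by apply: integrable_add; exact: integrable_scale.
have le w : g (X w) * (Y w - m x) ^+ 2 <=
    8 * M ^+ 2 * g (X w) + 2 * (g (X w) * eps w ^+ 2).
  have -> : 8 * M ^+ 2 * g (X w) + 2 * (g (X w) * eps w ^+ 2) =
    g (X w) * (8 * M ^+ 2 + 2 * eps w ^+ 2) by ring.
  rewrite ler_wpM2l//; first by case/andP: (g01 (X w)).
  have := mM xc; have := mM (Xc w); rewrite YE !ler_norml => /andP[a1 a2] /andP[b1 b2].
  have : (m (X w) - m x) ^+ 2 <= 4 * M ^+ 2 by nra.
  by have := sqr_ge0 (m (X w) - m x - eps w); nra.
have gU0 w : 0 <= g (X w) * (Y w - m x) ^+ 2.
  by rewrite mulr_ge0 ?sqr_ge0//; case/andP: (g01 (X w)).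
have igU : integrableR P (fun w => g (X w) * (Y w - m x) ^+ 2).
  apply: (integrable_le _ ib) => [|w]; last by rewrite ger0_norm.
  by apply: measurable_funM => //; apply: measurable_funX; exact: measurable_funB.
split=> //.
apply: (@le_trans _ _ (\int[P]_w (8 * M ^+ 2 * g (X w) + 2 * (g (X w) * eps w ^+ 2)))).
  by apply: le_Rintegral => // w _; exact: le.
rewrite RintegralD//; [|exact: integrable_scale..].
rewrite !RintegralZl// Ege /D.
have : 0 <= \int[P]_w g (X w) by apply: Rintegral_ge0 => w _; case/andP: (g01 (X w)).
by move=> Ig0; have := ler_wpM2l Ig0 e2; lra.
Qed.

Lemma regression_first_moment (X : {RV P >-> d.-tuple R}) (Y : {RV P >-> R})
    (g G : d.-tuple R -> R) :
  regression_pair m sigma X Y ->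
  measurable_fun setT g -> (forall z, 0 <= g z <= 1) ->
  integrableR P (fun w => G (X w)) ->
  (forall z, unit_cube z -> g z * `|m x - m z| <= G z) ->
  `|\int[P]_w (g (X w) * (Y w - m x))| <= \int[P]_w G (X w).
Proof.
move=> [[Xc _] [eps [YE Leps indXe]]] mg g01 iG gG.
have [i2 e2 e1] := epsC Leps.
have mgX : measurable_fun setT (fun w => g (X w)) by exact: measurableT_comp.
have ig : integrableR P (fun w => g (X w)).
  apply: (@integrable_bounded _ _ _ P 1) => // w.
  by case/andP: (g01 (X w)) => g0 g1; rewrite ger0_norm.
have ie : integrableR P (fun w => eps w) by exact: integrable_of_sqr.
have [ige Ege] := independent_expectation
  (independent2_comp mg (@measurable_id _ R setT) indXe) ig ie.
(* [Y w - eps w] stands for [m (X w)]: it is measurable as a difference of random variables, while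
   [m] is arbitrary off the cube. *)
have gle w : `|g (X w) * (Y w - eps w - m x)| <= G (X w).
  have -> : Y w - eps w - m x = m (X w) - m x by rewrite YE addrK.
  rewrite normrM distrC ger0_norm; first exact: gG.
  by case/andP: (g01 (X w)).
have im : integrableR P (fun w => g (X w) * (Y w - eps w - m x)).
  apply: (integrable_le _ iG) => //.
  by apply: measurable_funM => //; apply: measurable_funB => //; exact: measurable_funB.
have -> : \int[P]_w (g (X w) * (Y w - m x)) = \int[P]_w (g (X w) * (Y w - eps w - m x)).
  transitivity (\int[P]_w (g (X w) * (Y w - eps w - m x) + g (X w) * eps w)).
    by apply: eq_Rintegral => w _; ring.
  by rewrite RintegralD// Ege e1 mulr0 addr0.
apply: (le_trans (le_normr_Rintegral measurableT im)).
apply: le_Rintegral => //; exact: (integrable_norm im).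
Qed.

End regression.

Lemma centered_kernel_le1 (R : realType) (d k : nat) (x z : d.-tuple R) :
  (0 < d)%N -> centered_kernel k x z <= 1.
Proof.
move=> d0; rewrite centered_kernelE.
have d1 : d%:R != 0 :> R by rewrite pnatr_eq0 -lt0n.
have := multinomial_weight_sum k (fun _ : 'I_d => 1 : R).
rewrite sumr_const card_ord divff// expr1n => <-; apply: ler_sum => f _.
apply: ler_wpM2l; first exact: multinomial_weight_ge0.
apply: ler_prod => j _; rewrite expr1n ler0n/=.
by case: (_ == _).
Qed.

(** The l1 distance dominates the Euclidean one and separates the coordinates, as the kernel does;
    summing over them yields the factor [d] of the bias. The absolute value covers a negative
    [L]. *)
Lemma lipschitz_dist_sum (R : realType) (d : nat) (L : R) (m : d.-tuple R -> R)
    (x z : d.-tuple R) : lipschitz_on_cube L m -> unit_cube x -> unit_cube z ->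
  `|m x - m z| <= `|L| * \sum_(j < d) `|tnth x j - tnth z j|.
Proof.
move=> mL xc zc; apply: (le_trans (mL _ _ xc zc)).
apply: (@le_trans _ _ (`|L| * euclidean_dist x z)).
  by rewrite ler_wpM2r ?ler_norm// sqrtr_ge0.
rewrite ler_wpM2l//; have s0 : 0 <= \sum_(j < d) `|tnth x j - tnth z j| by exact: sumr_ge0.
rewrite -(ger0_norm s0) -sqrtr_sqr ler_wsqrtr// expr2 mulr_suml; apply: ler_sum => j _.
rewrite -(real_normK (num_real (_ - _))) expr2 ler_wpM2l// (bigD1 j)//= lerDl.
exact: sumr_ge0.
Qed.

(** [sup] dominates its set only if the set has an upper bound; the Lipschitz condition on the cube
    supplies one. *)
Lemma lipschitz_sup_norm (R : realType) (d : nat) (L : R) (m : d.-tuple R -> R)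
    (z : d.-tuple R) : lipschitz_on_cube L m -> unit_cube z -> `|m z| <= sup_norm m.
Proof.
move=> mL zc; apply: ub_le_sup; last by exists z.
exists (`|m z| + `|L| * d%:R) => _ [y yc <-].
have -> : m y = m z + (m y - m z) by ring.
apply: (le_trans (ler_normD _ _)); rewrite lerD2l.
apply: (le_trans (lipschitz_dist_sum mL yc zc)); rewrite ler_wpM2l//.
have -> : d%:R = \sum_(j < d) 1 :> R by rewrite sumr_const card_ord.
apply: ler_sum => j _; have /andP[y0 y1] := yc j; have /andP[z0 z1] := zc j.
by rewrite ler_norml; lra.
Qed.

(** * Numerator, denominator and bad event *)

Section risk.
Context (R : realType) (d k : nat) (m : d.-tuple R -> R) (sigma L M C : R)
  (x : d.-tuple R).
Hypothesis mL : lipschitz_on_cube L m.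
Hypothesis mM : forall z, unit_cube z -> `|m z| <= M.
Hypothesis xc : unit_cube x.
Hypothesis C0 : 0 <= C.
Hypothesis epsC : forall (disp : measure_display) (T : measurableType disp)
    (P : probability T R) (eps : {RV P >-> R}),
    (forall A, measurable A -> distribution P eps A = centered_normal sigma A) ->
  [/\ integrableR P (fun w => eps w ^+ 2), \int[P]_w (eps w ^+ 2) <= C
     & \int[P]_w eps w = 0].
Hypotheses (d0 : (0 < d)%N) (k0 : (0 < k)%N).
Context (disp : measure_display) (T : measurableType disp) (P : probability T R).
Local Notation n := (2 ^ k)%N.
Context (X : 'I_n -> {RV P >-> d.-tuple R}) (Y : 'I_n -> {RV P >-> R}).
Hypothesis XY : regression_sample m sigma X Y.

Let D := 8 * M ^+ 2 + 2 * C.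
(** The bound on n E K^2, of order k^(-(d-1)/2). *)
Let s := 8 ^+ d * Num.sqrt (d%:R / k%:R) ^+ d.-1 : R.
Let rho := 1 - 1 / (2 * d%:R) : R.

Let K i w := centered_kernel k x (X i w).
Let U i w := Y i w - m x.
Let S w := \sum_i K i w.
Let Z i w := (X i w, Y i w).

Let mZ i : measurable_fun setT (Z i).
Proof. exact: measurable_fun_pair. Qed.

Let mK i : measurable_fun setT (K i).
Proof. exact: (measurableT_comp (measurable_centered_kernel x k)). Qed.

Let mU i : measurable_fun setT (U i).
Proof. exact: measurable_funB. Qed.

Let K01 z : 0 <= centered_kernel k x z <= 1.
Proof. by rewrite centered_kernel_ge0 centered_kernel_le1. Qed.

Let nE : n%:R * (1 / 2) ^+ k = 1 :> R.
Proof. by rewrite natrX -exprMn mulrC divfK// expr1n. Qed.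

Let D0 : 0 <= D.
Proof. by apply: addr_ge0; apply: mulr_ge0 => //; exact: sqr_ge0. Qed.

(** The bounds on the second moment and on the mean of one summand both carry a factor 2^-k, which
    the number of summands cancels ([nE]). *)
Lemma numerator_second_moment :
  integrableR P (fun w => (\sum_i K i w * U i w) ^+ 2) /\
  \int[P]_w ((\sum_i K i w * U i w) ^+ 2) <= D * s + (`|L| * d%:R * rho ^+ k) ^+ 2.
Proof.
have mh : measurable_fun setT (fun z : d.-tuple R * R => centered_kernel k x z.1 * (z.2 - m x)).
  apply: measurable_funM; last exact: measurable_funB.
  exact: (measurableT_comp (measurable_centered_kernel x k)).
have H2 i : integrableR P (fun w => (K i w * U i w) ^+ 2) /\
    \int[P]_w ((K i w * U i w) ^+ 2) <= D * ((1 / 2) ^+ k * s).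
  have K2 z : 0 <= centered_kernel k x z ^+ 2 <= 1.
    by case/andP: (K01 z) => K0 K1; rewrite sqr_ge0 exprn_ile1.
  have [] := regression_second_moment mM xc epsC (XY.1 i)
    (measurable_funX 2 (measurable_centered_kernel x k)) K2.
  have -> : (fun w => (K i w * U i w) ^+ 2) =
      (fun w => centered_kernel k x (X i w) ^+ 2 * (Y i w - m x) ^+ 2).
    by apply/funext => w; rewrite exprMn.
  move=> I1 I2; split=> //; apply: (le_trans I2); rewrite ler_wpM2l//.
  exact: (centered_kernel_sqr_mean xc (XY.1 i).1 d0 k0).
have [I1 I2] : integrableR P (fun w => (\sum_i K i w * U i w) ^+ 2) /\
    \int[P]_w ((\sum_i K i w * U i w) ^+ 2) <= n%:R * (D * ((1 / 2) ^+ k * s)) +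
      (n%:R * (`|L| * d%:R * ((1 / 2) ^+ k * rho ^+ k))) ^+ 2.
  apply: second_moment_sum.
  - by move=> i; exact: measurable_funM.
  - by move=> i; exact: (H2 i).1.
  - move=> i j ij.
    exact: (independent2_comp mh mh (mutually_independent_pair XY.2 ij)).
  - by move=> i; exact: (H2 i).2.
  move=> i.
  (* The kernel times the l1 distance is not a combination of cell indicators; [G] dominates it and
     is one, so its mean is explicit. *)
  pose G z := \sum_(j < d) `|L| * (\sum_(f : {ffun 'I_d -> 'I_k.+1} | (\sum_j f j)%N == k)
    multinomial_weight R f * (1 / 2) ^+ f j * same_cells x (fun j => f j) z).
  have iG j : integrableR P (fun w => \sum_(f : {ffun 'I_d -> 'I_k.+1} | (\sum_j f j)%N == k)
    multinomial_weight R f * (1 / 2) ^+ f j * same_cells x (fun j => f j) (X i w)).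
    by have [] := Rintegral_cells_sum xc (XY.1 i).1
      (fun f : {ffun 'I_d -> 'I_k.+1} => (\sum_j f j)%N == k)
      (fun f => multinomial_weight R f * (1 / 2) ^+ f j) (fun f j => f j).
  apply: (le_trans (regression_first_moment (G := G) epsC (XY.1 i)
     (measurable_centered_kernel x k) K01 _ _)).
  - by apply: integrable_bigsum => j; exact: integrable_scale.
  - move=> z zc; apply: (@le_trans _ _ (centered_kernel k x z *
       (`|L| * \sum_(j < d) `|tnth x j - tnth z j|))).
      by apply: ler_wpM2l; [exact: centered_kernel_ge0|exact: lipschitz_dist_sum].
    rewrite mulrCA /G -mulr_sumr ler_wpM2l// mulr_sumr; apply: ler_sum => j _.
    exact: centered_kernel_dist_le.
  rewrite /G Rintegral_bigsum; last by move=> j; exact: integrable_scale.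
  rewrite (eq_bigr (fun=> `|L| * ((1 / 2) ^+ k * rho ^+ k))).
    by rewrite sumr_const card_ord -[_ *+ d]mulr_natr mulrAC.
  move=> j _; rewrite RintegralZl//.
  by rewrite (centered_kernel_dist_mean xc (XY.1 i).1).
split=> //; apply: (le_trans I2).
have E (a b c e : R) : a * (b * (c * e)) = (a * c) * (b * e) by ring.
by rewrite E [n%:R * (`|L| * _ * _)]E nE !mul1r.
Qed.

Lemma denominator_variance :
  integrableR P (fun w => (S w - 1) ^+ 2) /\ \int[P]_w ((S w - 1) ^+ 2) <= s.
Proof.
pose h : R := (1 / 2) ^+ k.
have SE w : S w - 1 = \sum_i (K i w - h).
  by rewrite sumrB sumr_const card_ord -[h *+ n]mulr_natl nE.
have -> : (fun w => (S w - 1) ^+ 2) = fun w => (\sum_i (K i w - h)) ^+ 2.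
  by apply/funext => w; rewrite SE.
have iK i : integrableR P (K i) := integrable_centered_kernel xc (XY.1 i).1 k.
have iK2 i : integrableR P (fun w => K i w ^+ 2) :=
  integrable_centered_kernel_sqr xc (XY.1 i).1 k.
have EK i : \int[P]_w K i w = h := centered_kernel_mean xc (XY.1 i).1 k d0.
have VE i : (fun w => (K i w - h) ^+ 2) = fun w => K i w ^+ 2 + ((- (2 * h)) * K i w + h ^+ 2).
  by apply/funext => w; ring.
have il i : integrableR P (fun w => (- (2 * h)) * K i w + h ^+ 2).
  by apply: integrable_add; [exact: integrable_scale|exact: integrable_cst].
have mh : measurable_fun setT (fun z : d.-tuple R * R => centered_kernel k x z.1 - h).
  apply: measurable_funB => //.
  exact: (measurableT_comp (measurable_centered_kernel x k)).
have [I1 I2] : integrableR P (fun w => (\sum_i (K i w - h)) ^+ 2) /\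
    \int[P]_w ((\sum_i (K i w - h)) ^+ 2) <= n%:R * (h * s) + (n%:R * 0) ^+ 2.
  apply: second_moment_sum.
  - by move=> i; exact: measurable_funB.
  - by move=> i; rewrite VE; exact: integrable_add.
  - move=> i j ij.
    exact: (independent2_comp mh mh (mutually_independent_pair XY.2 ij)).
  - move=> i; rewrite VE RintegralD// RintegralD//; last 2 first.
    + exact: integrable_scale.
    + exact: integrable_cst.
    rewrite RintegralZl// EK Rintegral_const.
    have := centered_kernel_sqr_mean xc (XY.1 i).1 d0 k0.
    rewrite -/s -/h => H; have := sqr_ge0 h; rewrite /K in H *; nra.
  - move=> i; rewrite RintegralB//; last exact: integrable_cst.
    by rewrite EK Rintegral_const subrr normr0.
split=> //; apply: (le_trans I2).
by rewrite mulrA nE mulr0 expr0n addr0 mul1r.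
Qed.

(** Whatever its own code, [U i] has conditional second moment at most [D]: the form in which
    [code_conditioning] wants it. *)
Let cU i : integrableR P (fun w => U i w ^+ 2) /\
  forall b, \int[P]_w ((cell_code x k (X i w) == b)%:R * U i w ^+ 2) <=
    D * \int[P]_w (cell_code x k (X i w) == b)%:R.
Proof.
split.
  have g01 (z : d.-tuple R) : 0 <= (1 : R) <= 1 by rewrite ler01 lexx.
  have m1 : measurable_fun setT (fun _ : d.-tuple R => 1 : R) by [].
  have [+ _] := regression_second_moment mM xc epsC (XY.1 i) m1 g01.
  congr (integrable _ _ _); apply/funext => w /=; by rewrite mul1r.
move=> b; have g01 (z : d.-tuple R) : 0 <= ((cell_code x k z == b)%:R : R) <= 1.
  by case: (_ == _); rewrite ?ler01 ?lexx.
have mg : measurable_fun setT (fun z : d.-tuple R => (cell_code x k z == b)%:R : R).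
  by apply: (measurable_fun_code (fun a => (a == b)%:R)) => a; exact: measurable_cell_code.
by have [] := regression_second_moment mM xc epsC (XY.1 i) mg g01.
Qed.

(* The weight of observation [i] in the estimator, cut off to the event [S < 1/2]. *)
Let Phi i (v : {ffun 'I_n -> {ffun 'I_d * 'I_k.+1 -> bool}}) : R :=
  let S := \sum_l kernel_of_code R (v l) in
  if S < 1 / 2 then kernel_of_code R (v i) / S else 0.

Let code w := [ffun l => cell_code x k (X l w)].

Let S_ge0 w : 0 <= S w.
Proof. by apply: sumr_ge0 => i _; exact: centered_kernel_ge0. Qed.

Let PhiE i w : Phi i (code w) = if S w < 1 / 2 then K i w / S w else 0.
Proof.
have E l : kernel_of_code R (code w l) = K l w by rewrite ffunE kernel_of_codeE.
by rewrite /Phi E (eq_bigr (K^~ w))// => l _; exact: E.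
Qed.

Let measurable_code_fun (phi : {ffun 'I_n -> {ffun 'I_d * 'I_k.+1 -> bool}} -> R) :
  measurable_fun setT (fun w => phi (code w)).
Proof.
apply: measurable_fun_code => v; apply: measurable_code_family => l b.
rewrite -[X in measurable X]setTI.
exact: (measurable_funPT (X l) measurableT _ (measurable_cell_code x b)).
Qed.

Let Phi_ge0 i v : 0 <= Phi i v.
Proof.
have K0 b : 0 <= @kernel_of_code R d k b.
  apply: sumr_ge0 => f _; apply: mulr_ge0; first exact: multinomial_weight_ge0.
  exact: prodr_ge0.
by rewrite /Phi; case: ifP => // _; rewrite divr_ge0// sumr_ge0.
Qed.

Lemma bad_event_second_moment :
  integrableR P (fun w => \sum_i Phi i (code w) * U i w ^+ 2) /\
  \int[P]_w (\sum_i Phi i (code w) * U i w ^+ 2) <= 4 * D * s.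
Proof.
have mc b : measurable ((fun z : d.-tuple R * R => cell_code x k z.1) @^-1` [set b]).
  rewrite -[X in measurable X]setTI.
  exact: (measurable_fst measurableT _ (measurable_cell_code x b)).
have mu : measurable_fun setT (fun z : d.-tuple R * R => (z.2 - m x) ^+ 2).
  by apply: measurable_funX; exact: measurable_funB.
have H i := code_conditioning mZ XY.2 mc mu (fun z => sqr_ge0 _) (Phi_ge0 i) (cU i).1 (cU i).2.
split; first by apply: integrable_bigsum => i; exact: (H i).1.
have [IS ES] := denominator_variance.
have iPhi i : integrableR P (fun w => Phi i (code w)).
  apply: (@integrable_bounded _ _ _ P 1) => [|w]; first exact: measurable_code_fun.
  rewrite ger0_norm// PhiE; case: ifP => // _.
  have [->|S0] := eqVneq (S w) 0; first by rewrite invr0 mulr0.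
  rewrite ler_pdivrMr ?lt0r ?S0 ?S_ge0// mul1r /S (bigD1 i)//= lerDl.
  by apply: sumr_ge0 => l _; exact: centered_kernel_ge0.
rewrite Rintegral_bigsum; last by move=> i; exact: (H i).1.
apply: (@le_trans _ _ (D * \sum_i \int[P]_w Phi i (code w))).
  by rewrite mulr_sumr; apply: ler_sum => i _; exact: (H i).2.
rewrite (mulrC 4) -mulrA ler_wpM2l// -Rintegral_bigsum//.
apply: (@le_trans _ _ (\int[P]_w (4 * (S w - 1) ^+ 2))); last first.
  by rewrite RintegralZl// ler_wpM2l.
apply: le_Rintegral => //; first exact: integrable_bigsum.
  exact: integrable_scale.
move=> w _.
have -> : \sum_i Phi i (code w) = \sum_i (if S w < 1 / 2 then K i w / S w else 0).
  by apply: eq_bigr => i _; exact: PhiE.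
(* The weights add up to 1 when 0 < S < 1/2, and to 0 when S = 0 since division by 0 yields 0. *)
have [S2|S2] := ltP (S w) (1 / 2); last first.
  by rewrite big1// mulr_ge0// sqr_ge0.
rewrite -mulr_suml; have [->|S0] := eqVneq (S w) 0.
  by rewrite invr0 mulr0 mulr_ge0// sqr_ge0.
by rewrite divff//; nra.
Qed.

(** Of the 8 D, one half comes from the numerator where S >= 1/2 and the other from the bad event; 4
    M^2 pays for the samples with S = 0, where the estimator vanishes. *)
Lemma centered_kerf_risk :
  ('E_P[fun w => ((centered_kerf k X Y x w - m x) ^+ 2)%R] <=
   ((8 * D + 4 * M ^+ 2) * s + 4 * (`|L| * d%:R * rho ^+ k) ^+ 2)%:E)%E.
Proof.
have [I1 E1] := numerator_second_moment.
have [I2 E2] := denominator_variance.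
have [I3 E3] := bad_event_second_moment.
have kE w : centered_kerf k X Y x w = (\sum_i Y i w * K i w) / S w by [].
have num w : \sum_i Y i w * K i w = \sum_i K i w * U i w + m x * S w.
  by rewrite mulr_sumr -big_split/=; apply: eq_bigr => i _; rewrite /U; ring.
pose F w := 4 * (\sum_i K i w * U i w) ^+ 2 +
  (4 * M ^+ 2 * (S w - 1) ^+ 2 + \sum_i Phi i (code w) * U i w ^+ 2).
have M2 : m x ^+ 2 <= M ^+ 2.
  by rewrite -(real_normK (num_real _)) lerXn2r ?nnegrE ?mM// (le_trans _ (mM xc)).
have le w : (centered_kerf k X Y x w - m x) ^+ 2 <= F w.
  have B0 : 0 <= \sum_i Phi i (code w) * U i w ^+ 2.
    by apply: sumr_ge0 => i _; apply: mulr_ge0; [exact: Phi_ge0|exact: sqr_ge0].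
  have A0 : 0 <= (\sum_i K i w * U i w) ^+ 2 by exact: sqr_ge0.
  have MS0 : 0 <= M ^+ 2 * (S w - 1) ^+ 2 by apply: mulr_ge0; exact: sqr_ge0.
  rewrite kE num /F; have [S2|S2] := leP (1 / 2) (S w).
    have S0 : S w != 0 by rewrite gt_eqF//; lra.
    have -> : (\sum_i K i w * U i w + m x * S w) / S w - m x = (\sum_i K i w * U i w) / S w.
      by field.
    rewrite expr_div_n ler_pdivrMr ?exprn_gt0//; last lra.
    (* Dividing the squared numerator by S^2 costs a factor 4 at most. *)
    have S4 : 1 <= 4 * S w ^+ 2 by nra.
    have : (\sum_i K i w * U i w) ^+ 2 * 1 <= (\sum_i K i w * U i w) ^+ 2 * (4 * S w ^+ 2).
      by rewrite ler_wpM2l.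
    have : 0 <= (4 * M ^+ 2 * (S w - 1) ^+ 2 + \sum_i Phi i (code w) * U i w ^+ 2) * S w ^+ 2.
      by apply: mulr_ge0; [lra|exact: sqr_ge0].
    lra.
  (* If S = 0 the error is m(x)^2 and (S - 1)^2 = 1. *)
  have [S0|S0] := eqVneq (S w) 0.
    rewrite S0 in MS0 *; rewrite invr0 mulr0 !sub0r !sqrrN expr1n mulr1; lra.
  (* If 0 < S < 1/2 the error is a convex average of the U_i, to which Jensen applies. *)
  have -> : (\sum_i K i w * U i w + m x * S w) / S w - m x = \sum_i K i w / S w * U i w.
    rewrite [RHS](eq_bigr (fun i => (K i w * U i w) / S w)); last by move=> i _; ring.
    by rewrite -mulr_suml; field.
  have -> : \sum_i Phi i (code w) * U i w ^+ 2 = \sum_i K i w / S w * U i w ^+ 2.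
    by apply: eq_bigr => i _; rewrite PhiE S2.
  apply: (le_trans (sqr_sum_weights_le _ _ _)).
  - by move=> i; rewrite divr_ge0// centered_kernel_ge0.
  - by rewrite -mulr_suml divff.
  - lra.
have mker : measurable_fun setT (fun w => (centered_kerf k X Y x w - m x) ^+ 2).
  apply: measurable_funX; apply: measurable_funB => //.
  (* The estimator is linear in the [Y i] with weights that are functions of the codes, so zeros of
     the denominator do not affect measurability. *)
  pose W i (v : {ffun 'I_n -> {ffun 'I_d * 'I_k.+1 -> bool}}) : R :=
    kernel_of_code R (v i) / \sum_l kernel_of_code R (v l).
  have -> : centered_kerf k X Y x = fun w => \sum_i Y i w * W i (code w).
    have E l w : kernel_of_code R (code w l) = K l w by rewrite ffunE kernel_of_codeE.
    apply/funext => w; rewrite kE mulr_suml; apply: eq_bigr => i _.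
    by rewrite /W E (eq_bigr (K^~ w)) ?mulrA// => l _; exact: E.
  apply: measurable_sum => i; apply: measurable_funM => //; exact: measurable_code_fun.
have iF : integrableR P F.
  by apply: integrable_add; [exact: integrable_scale|apply: integrable_add => //; exact: integrable_scale].
have ik : integrableR P (fun w => (centered_kerf k X Y x w - m x) ^+ 2).
  by apply: (integrable_le mker iF) => w; rewrite ger0_norm// sqr_ge0.
rewrite unlock -EFin_Rintegral// lee_fin.
apply: (@le_trans _ _ (\int[P]_w F w)); first by apply: le_Rintegral.
rewrite /F RintegralD//; last 2 first.
- exact: integrable_scale.
- by apply: integrable_add => //; exact: integrable_scale.
rewrite RintegralD//; last exact: integrable_scale.
rewrite !RintegralZl//.
have := ler_wpM2l (sqr_ge0 M) E2; lra.
Qed.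

End risk.

(** * The rate *)

Section rate.
Context (R : realType).

Lemma log2_exp2 (k : nat) : log2 (2 ^ k)%N%:R = k%:R :> R.
Proof.
have l2 : 0 < ln 2 :> R by rewrite ln_gt0// ltr1n.
by rewrite /log2 natrX lnXn// -[ln 2 *+ k]mulr_natr mulrAC divff ?mul1r// gt_eqF.
Qed.

Lemma log2_ge1 (k : nat) : (2 <= k)%N -> 1 <= log2 k%:R :> R.
Proof.
move=> k2; have l2 : 0 < ln 2 :> R by rewrite ln_gt0// ltr1n.
rewrite /log2 ler_pdivlMr// mul1r ler_ln ?posrE ?ltr0n ?ler_nat//.
exact: ltnW.
Qed.

Lemma powR_half (k d : nat) : k%:R `^ (d%:R / 2) = Num.sqrt k%:R ^+ d :> R.
Proof.
by rewrite mulrC powRrM powR12_sqrt// powR_mulrn// sqrtr_ge0.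
Qed.

(* [ln k <= 2 sqrt k], so the argument of the logarithm is at least of order [sqrt k]. *)
Lemma log_factor_ge1 (d : nat) : exists k0, forall k, (k0 <= k)%N -> (2 <= k)%N ->
  1 <= ln (ln (2 ^ k)%N%:R * k%:R `^ (d%:R / 2) / log2 k%:R ^+ d.+1) :> R.
Proof.
have l2 : 0 < ln 2 :> R by rewrite ln_gt0// ltr1n.
(* With ln k <= 2 sqrt k the argument of the logarithm is at least c sqrt k; the threshold below
   makes this at least e. *)
pose c : R := ln 2 * (ln 2 / 2) ^+ d.+1.
have c0 : 0 < c by rewrite mulr_gt0// exprn_gt0// divr_gt0.
exists (Num.truncn ((expR 1 / c) ^+ 2)).+1 => k kk k2.
have kp : 0 < k%:R :> R by rewrite ltr0n ltnW.
have sk : 0 < Num.sqrt k%:R :> R by rewrite sqrtr_gt0.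
have lk := log2_ge1 k2.
have : expR 1 <= c * Num.sqrt k%:R.
  rewrite -ler_pdivrMl// mulrC -(ger0_norm (_ : 0 <= expR 1 / c)); last first.
    by rewrite divr_ge0 ?expR_ge0// ltW.
  rewrite -sqrtr_sqr ler_wsqrtr// ltW// (lt_le_trans (truncnS_gt _))// ler_nat//.
move=> ce; rewrite -[leLHS]expRK ler_ln ?posrE ?expR_gt0//; last first.
  apply: divr_gt0; last by rewrite exprn_gt0// (lt_le_trans _ lk).
  apply: mulr_gt0; last exact: powR_gt0.
  by rewrite ln_gt0// ltr1n -{1}(expn0 2) ltn_exp2l// ltnW.
apply: (le_trans ce); rewrite powR_half natrX lnXn//.
rewrite ler_pdivlMr; last by rewrite exprn_gt0// (lt_le_trans _ lk).
have kS : k%:R = Num.sqrt k%:R ^+ 2 :> R by rewrite sqr_sqrtr// ltW.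
have lnk : ln k%:R <= 2 * Num.sqrt k%:R :> R.
  have -> : ln k%:R = 2 * ln (Num.sqrt k%:R) :> R by rewrite {1}kS lnXn// mulr_natl.
  rewrite ler_wpM2l//; have -> : Num.sqrt k%:R = 1 + (Num.sqrt k%:R - 1) :> R by ring.
  apply: (le_trans (le_ln1Dx _)); first by rewrite ltrBrDl subrr.
  by rewrite lerDr.
have : log2 k%:R ^+ d.+1 <= (2 * Num.sqrt k%:R / ln 2) ^+ d.+1 :> R.
  rewrite lerXn2r ?nnegrE//; first exact: le_trans lk.
    by rewrite divr_ge0 ?mulr_ge0 ?sqrtr_ge0// ltW.
  by rewrite /log2 ler_pM2r// invr_gt0.
have cs0 : 0 <= c * Num.sqrt k%:R by rewrite mulr_ge0 ?sqrtr_ge0// ltW.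
move=> /(ler_wpM2l cs0) /le_trans; apply; rewrite le_eqVlt; apply/orP; left; apply/eqP.
have q : (ln 2 / 2) ^+ d.+1 * (2 * Num.sqrt k%:R / ln 2) ^+ d.+1 = Num.sqrt k%:R ^+ d.+1 :> R.
  by rewrite -exprMn; congr (_ ^+ _); field; rewrite gt_eqF.
transitivity (ln 2 * Num.sqrt k%:R * Num.sqrt k%:R ^+ d.+1 : R); first by rewrite -q /c; ring.
rewrite -[ln 2 *+ k]mulr_natr; move: kS; move: (Num.sqrt k%:R : R) => t ->.
rewrite (exprS t d); ring.
Qed.

End rate.

Theorem theorem4 (R : realType) (d : nat) (sigma M : R)
    (d_gt0 : (0 < d)%N) (sigma_ge0 : 0 <= sigma) :
  exists C3 : R, forall L : R, exists c1 : R,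
  forall m : d.-tuple R -> R,
    lipschitz_on_cube L m -> sup_norm m = M ->
  forall (disp : measure_display) (T : measurableType disp)
    (P : probability T R) (k n : nat)
    (X : 'I_n -> {RV P >-> d.-tuple R}) (Y : 'I_n -> {RV P >-> R}),
    regression_sample m sigma X Y ->
    n = (2 ^ k)%N -> (2 <= k)%N ->
  forall x : d.-tuple R, unit_cube x ->
  ('E_P[fun w => ((centered_kerf k X Y x w - m x) ^+ 2)%R] <=
    (c1 * (1 - 1 / (2 * d%:R)) `^ (2 * log2 n%:R) +
     C3 * (log2 (log2 n%:R) ^+ d / log2 n%:R `^ ((d%:R - 1) / 2)) *
       ln (ln n%:R * log2 n%:R `^ ((d%:R - 1) / 2) /
           log2 (log2 n%:R) ^+ d))%:E)%E.
Proof.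
have [C C0 epsC] := centered_normal_moments sigma_ge0.
have [k0 Hk0] := log_factor_ge1 R d.-1.
have dE : d%:R - 1 = d.-1%:R :> R by rewrite -subn1 natrB.
pose D := 8 * M ^+ 2 + 2 * C.
have D0 : 0 <= D by apply: addr_ge0; apply: mulr_ge0 => //; exact: sqr_ge0.
(* The variance part of [centered_kerf_risk] with its power of [k] taken out; it involves neither
   [L] nor [k]. *)
pose B : R := (8 * D + 4 * M ^+ 2) * (8 ^+ d * Num.sqrt d%:R ^+ d.-1).
have B0 : 0 <= B.
  apply: mulr_ge0; last by apply: mulr_ge0; apply: exprn_ge0 => //; exact: sqrtr_ge0.
  by apply: addr_ge0; apply: mulr_ge0 => //; exact: sqr_ge0.
pose rho : R := 1 - 1 / (2 * d%:R).
have rho0 : 0 < rho.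
  have d1 : 1 <= d%:R :> R by rewrite ler1n.
  rewrite /rho subr_gt0 ltr_pdivrMr; lra.
pose Q k : R := B * (log2 k%:R ^+ d / k%:R `^ ((d%:R - 1) / 2)) *
  ln (ln (2 ^ k)%N%:R * k%:R `^ ((d%:R - 1) / 2) / log2 k%:R ^+ d).
(* The excess of the variance part over the second term of the bound. For small [k] the logarithm
   may be below 1, or negative, and [E k] positive. *)
pose E k : R := B / k%:R `^ ((d%:R - 1) / 2) - Q k.
(* The first summand pays for the squared bias. In the sum, the term of index [k] alone, multiplied
   by [rho ^+ (2 * k)], gives [|E k|]; division by these powers is possible because [rho] is
   positive. *)
exists B => L; exists (4 * (`|L| * d%:R) ^+ 2 + \sum_(j < k0) `|E j| / rho ^+ (2 * j)).
move=> m mL mM disp T P k n X Y XY nE k2 x xc; subst n.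
have k_gt0 : (0 < k)%N by exact: ltnW.
have mMz z : unit_cube z -> `|m z| <= M by move=> zc; rewrite -mM; exact: lipschitz_sup_norm mL zc.
apply: (le_trans (centered_kerf_risk mL mMz xc C0 epsC d_gt0 k_gt0 XY)).
rewrite lee_fin !log2_exp2 -/(Q k) -/rho.
have -> : rho `^ (2 * k%:R) = rho ^+ (2 * k) by rewrite -natrM powR_mulrn// ltW.
have -> : (8 * (8 * M ^+ 2 + 2 * C) + 4 * M ^+ 2) *
    (8 ^+ d * Num.sqrt (d%:R / k%:R) ^+ d.-1) = B / k%:R `^ ((d%:R - 1) / 2).
  rewrite /B -/D dE powR_half sqrtrM// sqrtrV// expr_div_n; ring.
have -> : 4 * (`|L| * d%:R * rho ^+ k) ^+ 2 = 4 * (`|L| * d%:R) ^+ 2 * rho ^+ (2 * k).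
  by rewrite exprMn mulrA mulnC exprM.
have S0 : 0 <= \sum_(j < k0) `|E j| / rho ^+ (2 * j).
  by apply: sumr_ge0 => j _; rewrite divr_ge0// exprn_ge0// ltW.
have rk : 0 < rho ^+ (2 * k) by rewrite exprn_gt0.
suff : E k <= (\sum_(j < k0) `|E j| / rho ^+ (2 * j)) * rho ^+ (2 * k).
  by rewrite /E mulrDl; lra.
have [kk0|k0k] := ltnP k k0.
  rewrite -ler_pdivrMr//; apply: (@le_trans _ _ (`|E k| / rho ^+ (2 * k))).
    by rewrite ler_pM2r ?invr_gt0// ler_norm.
  rewrite (bigD1 (Ordinal kk0))//= lerDl.
  by apply: sumr_ge0 => j _; rewrite divr_ge0// exprn_ge0// ltW.
apply: (@le_trans _ _ 0); last by rewrite mulr_ge0// ltW.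
rewrite /E subr_le0 /Q dE.
have K0 : 0 < k%:R `^ (d.-1%:R / 2) :> R by rewrite powR_gt0// ltr0n.
have := Hk0 k k0k k2; rewrite prednK// => ln1.
(* The iterated logarithm is at least 1 for k >= 2, so like the logarithm it only enlarges the
   second term. *)
have l1 : 1 <= log2 k%:R ^+ d :> R by rewrite exprn_ege1// log2_ge1.
rewrite -mulrA ler_wpM2l// -mulrA mulrCA -[leLHS]mulr1 ler_wpM2l ?invr_ge0 ?(ltW K0)//.
by rewrite -[leLHS]mulr1 ler_pM.
Qed.
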